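(* Let $\mathscr{A}$ be a unital $C^*$-algebra and let $\mathscr{A}_1,\mathscr{A}_2\subseteq\mathscr{A}$ be unital $C^*$-subalgebras with units $1_{\mathscr{A}_1}$ and $1_{\mathscr{A}_2}$ (it is not assumed that $\mathscr{A},\mathscr{A}_1,\mathscr{A}_2$ have a common unit). Then the following statements are equivalent: (1) $\mathscr{A}_1$ and $\mathscr{A}_2$ are module independent in $\mathscr{A}$. (2) There is a constant $m>0$ such that for each pair of states $\varphi_1\in S(\mathscr{A}_1)$, $\varphi_2\in S(\mathscr{A}_2)$ there is a state $\varphi\in S(\mathscr{A})$ with $\varphi(1_{\mathscr{A}_1})\ge m$, $\varphi(1_{\mathscr{A}_2})\ge m$, such that $\mathscr{N}_{\varphi|\mathscr{A}_1}=\mathscr{N}_{\varphi_1}$ and $\mathscr{N}_{\varphi|\mathscr{A}_2}=\mathscr{N}_{\varphi_2}$. (3) There is a constant $m>0$ such that for each pair of pure states $\varphi_1$ on $\mathscr{A}_1$ and $\varphi_2$ on $\mathscr{A}_2$ there is a state $\varphi$ on $\mathscr{A}$ with $\varphi(1_{\mathscr{A}_1})\ge m$, $\varphi(1_{\mathscr{A}_2})\ge m$, such that the restrictions of $\varphi$ to $\mathscr{A}_1$ and $\mathscr{A}_2$ are scalar multiples of $\varphi_1$ and $\varphi_2$, respectively. (4) There is a constant $m>0$ such that for each pair of states $\varphi_1$ on $\mathscr{A}_1$ and $\varphi_2$ on $\mathscr{A}_2$ there is a state $\varphi$ on $\mathscr{A}$ with $\varphi(1_{\mathscr{A}_1})\ge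 m$, $\varphi(1_{\mathscr{A}_2})\ge m$, such that the restrictions of $\varphi$ to $\mathscr{A}_1$ and $\mathscr{A}_2$ are scalar multiples of $\varphi_1$ and $\varphi_2$, respectively.
   Context: A state on a $C^*$-algebra is a positive linear functional of norm one; $S(\mathscr{B})$ is the set of states of $\mathscr{B}$. For an element $x$ of a $C^*$-algebra, $|x|=(x^*x)^{1/2}$. For a state (or positive functional) $\psi$ on a $C^*$-algebra $\mathscr{B}$, its left kernel is $\mathscr{N}_\psi=\{x\in\mathscr{B}:\psi(x^*x)=0\}$; $\varphi|\mathscr{B}$ denotes the restriction of $\varphi$ to a subalgebra $\mathscr{B}$. Module independence of $C^*$-subalgebras: unital $C^*$-subalgebras $\mathscr{A}_1,\mathscr{A}_2$ (possibly with different units) of a unital $C^*$-algebra $\mathscr{A}$ are module independent if there are constants $m,M>0$ such that for every pair of states $\varphi_1\in S(\mathscr{A}_1)$, $\varphi_2\in S(\mathscr{A}_2)$ there is a state $\varphi\in S(\mathscr{A})$ with $$m\,\varphi_i(|x|)\le\varphi(|x|)\le M\,\varphi_i(|x|^2)^{1/2}\qquad\text{for all }x\in\mathscr{A}_i,\ i=1,2.$$ *)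

(* Defs.v *)
From HB Require Import structures.
From mathcomp Require Import all_boot all_order all_algebra.
From mathcomp Require Import complex.
From mathcomp Require Import all_classical all_reals all_analysis.
Set Implicit Arguments.
Unset Strict Implicit.
Unset Printing Implicit Defensive.
Import Order.TTheory GRing.Theory Num.Theory.
Import numFieldNormedType.Exports.

Local Open Scope classical_set_scope.
Local Open Scope complex_scope.
Local Open Scope ring_scope.

HB.mixin Record NormedModule_isCStarAlgebra (R : realType) A
    of CompleteNormedModule R[i] A := {
  cstar_one : A ;
  cstar_mul : A -> A -> A ;
  cstar_mulA : associative cstar_mul ;
  cstar_mul1r : left_id cstar_one cstar_mul ;
  cstar_mulr1 : right_id cstar_one cstar_mul ;
  cstar_mulDl : left_distributive cstar_mul +%R ;
  cstar_mulDr : right_distributive cstar_mul +%R ;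
  cstar_scaleAl : forall (c : R[i]) (x y : A),
    c *: cstar_mul x y = cstar_mul (c *: x) y ;
  cstar_scaleAr : forall (c : R[i]) (x y : A),
    c *: cstar_mul x y = cstar_mul x (c *: y) ;
  star : A -> A ;
  starK : involutive star ;
  starD : {morph star : x y / x + y} ;
  starZ : forall (c : R[i]) (x : A), star (c *: x) = Num.conj c *: star x ;
  starM : forall x y : A, star (cstar_mul x y) = cstar_mul (star y) (star x) ;
  cstar_normM : forall x y : A, `|cstar_mul x y| <= `|x| * `|y| ;
  cstar_norm : forall x : A, `|cstar_mul (star x) x| = `|x| ^+ 2
}.

(* Norms take values in R[i], ordered by x <= y iff y - x is a nonnegative
   real.  The zero algebra is allowed.  The product is a field of the mixin,
   because Hierarchy-Builder does not accept the join of a ring structure and a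
   normed module structure (numDomainType would have to inherit from it); the
   ring structure is derived just below. *)
#[short(type="unitalCStarAlgType")]
HB.structure Definition UnitalCStarAlgebra (R : realType) :=
  {A of NormedModule_isCStarAlgebra R A & CompleteNormedModule R[i] A}.

HB.instance Definition _ (R : realType) (A : unitalCStarAlgType R) :=
  GRing.Zmodule_isPzRing.Build (UnitalCStarAlgebra.sort A)
    (@cstar_mulA R A) (@cstar_mul1r R A) (@cstar_mulr1 R A)
    (@cstar_mulDl R A) (@cstar_mulDr R A).

Section CStarAlgebra.
Context {R : realType} {A : unitalCStarAlgType R}.
Implicit Types (x y a e : A) (B : set A) (phi psi : A -> R[i]).

Definition spectrum x : set R[i] :=
  [set l : R[i] | ~ exists y, y * (x - l *: (1 : A)) = 1 /\ (x - l *: (1 : A)) * y = 1].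

Definition cstar_pos : set A :=
  [set a | star a = a /\ spectrum a `<=` [set l : R[i] | 0 <= l]].

Definition cstar_sqrt a : A := xget 0 [set b | cstar_pos b /\ b ^+ 2 = a].

Definition cstar_abs x : A := cstar_sqrt (star x * x).

(* e is the unit of B; it need not be the unit 1 of A. *)
Record unital_cstar_subalgebra B e : Prop := {
  subalg_linear : forall (c : R[i]) x y, B x -> B y -> B (c *: x + y) ;
  subalg_mul : forall x y, B x -> B y -> B (x * y) ;
  subalg_star : forall x, B x -> B (star x) ;
  subalg_closed : closed B ;
  subalg_unit : B e ;
  subalg_mul1l : forall x, B x -> e * x = x ;
  subalg_mul1r : forall x, B x -> x * e = x
}.

(* A functional on a subalgebra B is represented by a function on A, of which
   only the values on B matter: every notion below looks at phi on B only, so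
   that phi also stands for its own restriction to B. *)
Definition linear_on B phi : Prop :=
  forall (c : R[i]) x y, B x -> B y -> phi (c *: x + y) = c * phi x + phi y.

Definition positive_on B phi : Prop :=
  forall x, B x -> 0 <= phi (star x * x).

(* The functional phi has norm c on B: c is the supremum of |phi x| over the
   unit ball of B. *)
Definition has_norm_on B phi (c : R[i]) : Prop :=
  supremums [set `|phi x| | x in [set x | B x /\ `|x| <= 1]] c.

Definition states B : set (A -> R[i]) :=
  [set phi | [/\ linear_on B phi, positive_on B phi & has_norm_on B phi 1]].

(* Extreme points of the convex set of states of B. *)
Definition pure_states B : set (A -> R[i]) :=
  [set phi | states B phi /\
    forall (t : R) psi1 psi2, 0 < t < 1 -> states B psi1 -> states B psi2 ->
      (forall x, B x -> phi x = t%:C * psi1 x + (1 - t)%:C * psi2 x) ->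
      forall x, B x -> psi1 x = phi x /\ psi2 x = phi x].

Definition left_kernel B phi : set A :=
  [set x | B x /\ phi (star x * x) = 0].

(* The restriction of phi to B is a scalar multiple of psi. *)
Definition multiple_on B phi psi : Prop :=
  exists c : R[i], forall x, B x -> phi x = c * psi x.

Definition module_independent (A1 A2 : set A) : Prop :=
  exists m M : R, [/\ 0 < m, 0 < M &
    forall phi1 phi2, states A1 phi1 -> states A2 phi2 ->
      exists phi, [/\ states [set: A] phi,
        forall x, A1 x ->
          m%:C * phi1 (cstar_abs x) <= phi (cstar_abs x)
            <= M%:C * sqrtC (phi1 (cstar_abs x ^+ 2)) &
        forall x, A2 x ->
          m%:C * phi2 (cstar_abs x) <= phi (cstar_abs x)
            <= M%:C * sqrtC (phi2 (cstar_abs x ^+ 2))]].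

End CStarAlgebra.

(* Main.v *)
(** By the theorem of Hahn-Banach in the form of Mazur and Orlicz, a state of
    [A] restricting to multiples [c_i phi_i], [c_i >= m], exists as soon as for all
    [b_i] in [A_i] some state [phi] of [A] satisfies
    [Re phi (b1 + b2) >= c_1 Re phi1 b1 + c_2 Re phi2 b2] with [m <= c_i <= 1].
    Let [beta_i >= Re phi_i b_i] be the largest real part at [b_i] of a state of
    [A_i].  It is attained at a pure state [psi_i], and the hypothesis (2) or (3)
    for [psi1, psi2] gives a [phi] with [Re phi b_i = phi e_i * beta_i]: for (3)
    this is clear, and for (2) it holds because [phi], like [psi_i], annihilates
    the positive element [beta_i e_i - Re b_i].  So (2) and (3) both imply (4).
    The needed pure states come from a lexicographic maximization (Zorn).

    Positivity of [a = star a] is handled through the norm, [`|t - a| <= t] for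
    some [t >= 0], which needs no spectral theory; square roots are limits of an
    explicit iteration, and the agreement with the spectral definition follows
    from the Neumann series. *)

Require Import Defs.
From mathcomp Require Import all_boot all_order all_algebra.
From mathcomp Require Import complex.
From mathcomp Require Import all_classical all_reals all_analysis.
From mathcomp Require Import ring lra.
Set Implicit Arguments.
Unset Strict Implicit.
Unset Printing Implicit Defensive.
Import Order.TTheory GRing.Theory Num.Theory.
Import numFieldNormedType.Exports.
Local Open Scope classical_set_scope.
Local Open Scope complex_scope.
Local Open Scope ring_scope.

(** * Elements and norms *)

Local Notation "r *r x" := ((real_complex_def (Phant _) r) *: x) (at level 40).

Section RealScaling.
Context {R : realType} {V : lmodType R[i]}.
Implicit Types (x : V) (r s : R).

Lemma realCD r s : (r + s)%:C = r%:C + s%:C.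
Proof. exact: rmorphD. Qed.

Lemma realCN r : (- r)%:C = - r%:C.
Proof. exact: rmorphN. Qed.

Lemma realCM r s : (r * s)%:C = r%:C * s%:C.
Proof. exact: rmorphM. Qed.

Lemma conj_i : Num.conj ('i%C : R[i]) = - 'i%C.
Proof. by rewrite /Num.conj/=; congr Complex; rewrite oppr0. Qed.

Lemma mulii : 'i%C * 'i%C = -1 :> R[i].
Proof. by rewrite -(expr2 'i%C) sqr_i. Qed.

Lemma realZA r s x : r *r (s *r x) = (r * s) *r x.
Proof. by rewrite scalerA -realCM. Qed.

Lemma realZ1 x : 1 *r x = x.
Proof. by rewrite rmorph1 scale1r. Qed.

Lemma realZ0 x : 0 *r x = 0.
Proof. by rewrite rmorph0 scale0r. Qed.

Lemma realZDl r s x : (r + s) *r x = r *r x + s *r x.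
Proof. by rewrite realCD scalerDl. Qed.

Lemma realZNl r x : (- r) *r x = - (r *r x).
Proof. by rewrite realCN scaleNr. Qed.

Lemma realZBl r s x : (r - s) *r x = r *r x - s *r x.
Proof. by rewrite realZDl realZNl. Qed.

Lemma realZ2 x : 2 *r x = x + x.
Proof. by rewrite (_ : 2 = 1 + 1 :> R)// realZDl realZ1. Qed.

End RealScaling.

Section Basics.
Context {R : realType} {A : unitalCStarAlgType R}.
Implicit Types (x y a b e h k : A) (r s t : R) (B : set A).

Lemma cstarZl (c : R[i]) x y : (c *: x) * y = c *: (x * y).
Proof. by rewrite [in RHS]cstar_scaleAl. Qed.

Lemma cstarZr (c : R[i]) x y : x * (c *: y) = c *: (x * y).
Proof. by rewrite [in RHS]cstar_scaleAr. Qed.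

Lemma star_mul x y : star (x * y) = star y * star x.
Proof. exact: starM. Qed.

Lemma star0 : star (0 : A) = 0.
Proof. by apply: (@addrI _ (star 0)); rewrite -starD !addr0. Qed.

Lemma starN x : star (- x) = - star x.
Proof. by apply: (@addrI _ (star x)); rewrite -starD !subrr star0. Qed.

Lemma starB x y : star (x - y) = star x - star y.
Proof. by rewrite starD starN. Qed.

Lemma star1 : star (1 : A) = 1.
Proof. by rewrite -[LHS]mulr1 -[X in _ * X]starK -star_mul mulr1 starK. Qed.

Lemma starZr r x : star (r *r x) = r *r star x.
Proof. by rewrite starZ; congr (_ *: _); exact: conjc_real. Qed.

Definition nm x : R := complex.Re `|x|.

Lemma nmE x : `|x| = (nm x)%:C.
Proof. by rewrite /nm RRe_real// normr_real. Qed.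

Lemma nm_ge0 x : 0 <= nm x.
Proof. by rewrite -ler0c -nmE. Qed.

Lemma nm0 : nm (0 : A) = 0.
Proof. by rewrite /nm normr0. Qed.

Lemma nm_eq0 x : nm x <= 0 -> x = 0.
Proof.
move=> x0; apply: normr0_eq0; rewrite nmE.
by rewrite (le_anti (_ : nm x <= 0 <= nm x)) ?rmorph0// x0 nm_ge0.
Qed.

Lemma nmD x y : nm (x + y) <= nm x + nm y.
Proof. by rewrite -lecR realCD -!nmE ler_normD. Qed.

Lemma nmN x : nm (- x) = nm x.
Proof. by rewrite /nm normrN. Qed.

Lemma nmBC x y : nm (x - y) = nm (y - x).
Proof. by rewrite -nmN opprB. Qed.

Lemma nmB x y : nm (x - y) <= nm x + nm y.
Proof. by rewrite (le_trans (nmD _ _))// nmN. Qed.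

Lemma nmM x y : nm (x * y) <= nm x * nm y.
Proof. by rewrite -lecR realCM -!nmE; exact: cstar_normM. Qed.

Lemma nmZc (c : R[i]) x : nm (c *: x) = complex.Re `|c| * nm x.
Proof.
by rewrite /nm normrZ (nmE x) -[X in X * _](RRe_real (normr_real c)) -realCM.
Qed.

Lemma nmZ r x : nm (r *r x) = `|r| * nm x.
Proof. by rewrite nmZc normc_def/= expr0n addr0 sqrtr_sqr. Qed.

Lemma nmZ_ge0 r x : 0 <= r -> nm (r *r x) = r * nm x.
Proof. by move=> r0; rewrite nmZ ger0_norm. Qed.

Lemma nmC x : nm (star x * x) = nm x ^+ 2.
Proof. by apply: complexI; rewrite -nmE rmorphXn/= -nmE; exact: cstar_norm. Qed.

(** The C*-identity gives [nm x ^+ 2 <= nm (star x) * nm x]; cancel [nm x], then exchange [x] and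
    [star x]. *)
Lemma nm_star x : nm (star x) = nm x.
Proof.
have H y : nm y <= nm (star y).
  have := nmM (star y) y; rewrite nmC expr2.
  have [->|y0] := eqVneq (nm y) 0; first by rewrite nm_ge0.
  by rewrite ler_pM2r// lt0r y0 nm_ge0.
by apply/eqP; rewrite eq_le H -{2}(starK x) H.
Qed.

Lemma nm_sqr h : star h = h -> nm (h * h) = nm h ^+ 2.
Proof. by move=> hh; rewrite -nmC hh. Qed.

Lemma star_mulC x y : star x = x -> star y = y -> GRing.comm x y -> star (x * y) = x * y.
Proof. by move=> hx hy xy; rewrite star_mul hx hy xy. Qed.

(** The steps of [y] are at most those of [s], which is nondecreasing and bounded; so [y] is
    Cauchy. *)
Lemma dominated_cvg (y : nat -> A) (s : nat -> R) (M : R) :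
  (forall n, nm (y n.+1 - y n) <= s n.+1 - s n) -> (forall n, s n <= M) ->
  exists l : A, y @ \oo --> l.
Proof.
move=> ys sM.
have s1 n : s n <= s n.+1 by rewrite -subr_ge0 (le_trans _ (ys n))// nm_ge0.
have sm : {homo s : n m / (n <= m)%N >-> n <= m}.
  by apply/nondecreasing_seqP.
have ysm n (k : nat) : nm (y (n + k)%N - y n) <= s (n + k)%N - s n.
  elim: k => [|k ih]; first by rewrite addn0 !subrr nm0.
  rewrite addnS -(subrK (y (n + k)%N) (y _.+1)) -addrA (le_trans (nmD _ _))//.
  by rewrite -(subrK (s (n + k)%N) (s _.+1)) -addrA lerD.
suff : cvg (y @ \oo) by move=> /cvg_ex.
apply: cauchy_cvg; apply/cauchy_ballP => eps eps0.
have e0 : 0 < complex.Re eps by move: eps0; rewrite ltcE => /andP[].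
have epsE : eps = (complex.Re eps)%:C by rewrite RRe_real// gtr0_real.
have scvg : cvgn s.
  by apply: nondecreasing_is_cvgn => //; exists M => _ [n _ <-].
have [N _ HN] : \forall n \near \oo, `|limn s - s n| < complex.Re eps / 2.
  by move/cvgrPdist_lt : scvg; apply; rewrite divr_gt0.
have sN n : (N <= n)%N -> s n - s N < complex.Re eps / 2.
  move=> Nn; apply: le_lt_trans (HN N (leqnn N)).
  rewrite ger0_norm; first by rewrite lerD2r nondecreasing_cvgn_le.
  by rewrite subr_ge0 nondecreasing_cvgn_le.
have yN n : (N <= n)%N -> nm (y n - y N) < complex.Re eps / 2.
  by move=> Nn; rewrite -(subnKC Nn); apply: le_lt_trans (ysm _ _) (sN _ _); rewrite subnKC.
exists ([set y n | n in [set n | (N <= n)%N]], [set y n | n in [set n | (N <= n)%N]]).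
  by split; exists N => // n /= Nn; exists n.
move=> [_ _] /= [[n Nn <-] [m Nm <-]].
rewrite -ball_normE /ball_/= nmE epsE ltcR.
rewrite -(subrK (y N) (y n)) -addrA (le_lt_trans (nmD _ _))//.
by rewrite (nmBC (y N)) [ltRHS]splitr ltrD// yN.
Qed.

Lemma cvg_nm_lt (y : nat -> A) (l : A) r : y @ \oo --> l -> 0 < r ->
  exists n, nm (y n - l) < r /\ nm (y n.+1 - l) < r.
Proof.
move=> yl r0.
have [N _ HN] : \forall n \near \oo, `|l - y n| < r%:C.
  by move/cvgrPdist_lt : yl; apply; rewrite ltcR.
by exists N; rewrite !(nmBC _ l) -!ltcR -!nmE; split; apply: HN => /=.
Qed.

Lemma nm_lt0 x : (forall r, 0 < r -> nm x <= r) -> x = 0.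
Proof. by move=> H; apply: nm_eq0; apply/ler_addgt0Pr => r /H; rewrite add0r. Qed.

(** Lets additive identities along a sequence, such as self-adjointness or commutation, pass to its
    limit. *)
Lemma cvg_bounded_eq0 (y : nat -> A) (l : A) (F : A -> A) (K : R) : 0 <= K -> y @ \oo --> l ->
  {morph F : a b / a - b} -> (forall a, nm (F a) <= K * nm a) -> (forall n, F (y n) = 0) ->
  F l = 0.
Proof.
move=> K0 yl FB FK Fy; apply: nm_lt0 => r r0.
have K1 : 0 < 1 + K by rewrite ltr_wpDr.
have [n [+ _]] := cvg_nm_lt yl (divr_gt0 r0 K1).
rewrite ltr_pdivlMr// => yn; rewrite -nmN -sub0r -(Fy n) -FB.
apply: le_trans (FK _) _; have := nm_ge0 (y n - l); nra.
Qed.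

End Basics.

(** * The norm characterization of positivity *)

Section Positivity.
Context {R : realType} {A : unitalCStarAlgType R}.
Implicit Types (x y a b e h k : A) (s t : R) (B : set A).

Section Subalgebra.
Context {B : set A} {e : A} (hB : unital_cstar_subalgebra B e).

Lemma subalg0 : B 0.
Proof.
have [lin _ _ _ Be _ _] := hB.
by rewrite -(subrr e) addrC -scaleN1r; exact: lin.
Qed.

Lemma subalgZ (c : R[i]) x : B x -> B (c *: x).
Proof.
by case: hB => lin _ _ _ _ _ _ Bx; rewrite -[_ *: _]addr0; apply: lin => //; exact: subalg0.
Qed.

Lemma subalgD x y : B x -> B y -> B (x + y).
Proof. by case: hB => lin _ _ _ _ _ _ Bx By; rewrite -[x]scale1r; exact: lin. Qed.

Lemma subalgN x : B x -> B (- x).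
Proof. by rewrite -scaleN1r; exact: subalgZ. Qed.

Lemma subalgB x y : B x -> B y -> B (x - y).
Proof. by move=> Bx By; apply: subalgD => //; exact: subalgN. Qed.

Lemma star_subalg_unit : star e = e.
Proof.
have [_ _ st _ Be e1 _] := hB.
by have h := e1 _ (st _ Be); rewrite -[RHS]starK -h star_mul starK.
Qed.

Lemma nm_subalg_unit : nm e <= 1.
Proof.
have [_ _ _ _ Be e1 _] := hB.
have := nmC e; rewrite star_subalg_unit e1// expr2 => h.
by have := nm_ge0 e; nra.
Qed.

End Subalgebra.

Lemma subalgT : unital_cstar_subalgebra [set: A] 1.
Proof. by split => // x; rewrite ?mul1r ?mulr1. Qed.

Lemma nm1 : nm (1 : A) <= 1. Proof. exact: (nm_subalg_unit subalgT). Qed.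

Lemma nmBsqr x y : nm (x * x - y * y) <= (nm x + nm y) * nm (x - y).
Proof.
rewrite (_ : x * x - y * y = (x - y) * x + y * (x - y)); last first.
  by rewrite mulrBl mulrBr addrA subrK.
rewrite (le_trans (nmD _ _))// [leRHS]mulrDl lerD ?nmM//.
by rewrite mulrC nmM.
Qed.

(* The iteration [y := (h + y^2) / 2] is dominated by the same iteration on real
   numbers with [h := 1], which increases to [1]; its limit [y] satisfies
   [(1 - y)^2 = 1 - h]. *)
Lemma sqrt_iteration B e (hB : unital_cstar_subalgebra B e) h :
  B h -> star h = h -> nm h <= 1 ->
  exists y, [/\ B y, star y = y, nm y <= 1, y + y = h + y * y &
    forall z, GRing.comm z h -> GRing.comm z y].
Proof.
move=> Bh sh h1; have [_ Bmul _ Bclosed _ _ _] := hB.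
pose y n := iter n (fun y => 2^-1 *r (h + y * y)) 0.
pose s n := iter n (fun s : R => 2^-1 * (1 + s * s)) 0.
have yE n : y n.+1 = 2^-1 *r (h + y n * y n) by [].
have sE n : s n.+1 = 2^-1 * (1 + s n * s n) by [].
have s01 n : 0 <= s n <= 1.
  elim: n => [|n /andP[s0 s1]] /=; first by rewrite lexx ler01.
  by rewrite -/(s n); apply/andP; split; nra.
have ys n : nm (y n) <= s n.
  elim: n => [|n ih] /=; first by rewrite nm0.
  rewrite -/(s n) -/(y n) nmZ_ge0 ?invr_ge0// ler_pM2l ?invr_gt0//.
  rewrite (le_trans (nmD _ _))// lerD// (le_trans (nmM _ _))//.
  by rewrite ler_pM ?nm_ge0.
have yys n : nm (y n.+1 - y n) <= s n.+1 - s n.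
  elim: n => [|n ih].
    rewrite /= !mulr0 !addr0 !subr0 mulr1 nmZ_ge0 ?invr_ge0//.
    by rewrite ler_piMr ?invr_ge0.
  rewrite (_ : y n.+2 - y n.+1 = 2^-1 *r (y n.+1 * y n.+1 - y n * y n)); last first.
    by rewrite (yE n.+1) [X in _ - X = _](yE n) -scalerBr opprD addrACA subrr add0r.
  rewrite nmZ_ge0 ?invr_ge0// (_ : s n.+2 - s n.+1 =
    2^-1 * ((s n.+1 + s n) * (s n.+1 - s n))); last first.
    by rewrite (sE n.+1) (sE n); ring.
  rewrite ler_pM2l ?invr_gt0// (le_trans (nmBsqr _ _))// ler_pM ?nm_ge0//.
    by rewrite addr_ge0 ?nm_ge0.
  by rewrite lerD.
have [l yl] := dominated_cvg yys (fun n => proj2 (andP (s01 n))).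
exists l; split.
- apply: (closed_cvg B Bclosed _ l yl).
  apply: nearW; elim => [|n ih]; first exact: (subalg0 hB).
  apply: (subalgZ hB); apply: (subalgD hB) => //; exact: Bmul.
- apply/eqP; rewrite -subr_eq0; apply/eqP.
  apply: (cvg_bounded_eq0 (F := fun x => star x - x) (K := 2) _ yl) => //.
  + by move=> a b; rewrite starB !opprD !opprK addrACA.
  + by move=> a; rewrite mulr_natl mulr2n (le_trans (nmB _ _))// nm_star.
  + move=> n; apply/eqP; rewrite subr_eq0; apply/eqP.
    elim: n => [|n ih] /=; first exact: star0.
    by rewrite -/(y n) starZr starD star_mul sh ih.
- apply/ler_addgt0Pr => r r0; have [n [yn _]] := cvg_nm_lt yl r0.
  rewrite -(subrK (y n) l) addrC (le_trans (nmD _ _))//.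
  apply: lerD; last by rewrite nmBC ltW.
  by rewrite (le_trans (ys n))//; case/andP: (s01 n).
(* The error is [2 (l - y n.+1) + (y n ^ 2 - l ^ 2)], and its second term is at most
   [nm (y n) + nm l <= 1 + nm l] times [nm (y n - l)]. *)
- have K0 : 0 < 2 + (1 + nm l) by rewrite -addrA ltr_wpDr// addr_ge0// addr_ge0 ?nm_ge0.
  apply/eqP; rewrite -subr_eq0; apply/eqP/nm_lt0 => r r0.
  have [n [yn yn1]] := cvg_nm_lt yl (divr_gt0 r0 K0).
  have ynh : y n.+1 + y n.+1 = h + y n * y n.
    by rewrite -realZ2 realZA mulfV// realZ1.
  rewrite (_ : _ - _ = (l - y n.+1 + (l - y n.+1)) + (y n * y n - l * l)); last first.
    by rewrite [X in _ = X + _]addrACA -opprD ynh !opprD !addrA subrK.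
  apply: le_trans (nmD _ _) _; have := nmD (l - y n.+1) (l - y n.+1).
  have := nmBsqr (y n) l; rewrite (nmBC l).
  have := nm_ge0 l; have := nm_ge0 (y n); have := ys n; have /andP[_] := s01 n.
  move: yn yn1; rewrite !ltr_pdivlMr//; set d := nm (_ - l); set d' := nm (_ - l).
  have : 0 <= d by exact: nm_ge0.
  have : 0 <= d' by exact: nm_ge0.
  nra.
- move=> z zh; have zy n : GRing.comm z (y n).
    elim: n => [|n ih] /=; first exact: commr0.
    rewrite -/(y n) /GRing.comm cstarZl cstarZr; congr (_ *: _).
    by apply: commrD => //; exact: commrM.
  apply/eqP; rewrite -subr_eq0; apply/eqP.
  apply: (cvg_bounded_eq0 (F := fun x => z * x - x * z) (K := nm z + nm z) _ yl).
  + by rewrite addr_ge0 ?nm_ge0.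
  + by move=> a b; rewrite mulrBr mulrBl !opprD !opprK addrACA.
  + move=> a; rewrite (le_trans (nmB _ _))// [leRHS]mulrDl lerD ?nmM//.
    by rewrite mulrC nmM.
  + by move=> n; rewrite zy subrr.
Qed.

Definition psd a := star a = a /\ exists t, 0 <= t /\ nm (t *r (1 : A) - a) <= t.

(** The iteration for [e - a / t] gives [(e - y)^2 = a / t]; take [r = sqrt t (e - y)]. The bound on
    [sqrt t e - r = sqrt t y] makes the lemma applicable to [r] in turn. *)
Lemma sqrt_core B e (hB : unital_cstar_subalgebra B e) a t :
  B a -> star a = a -> 0 <= t -> nm (t *r e - a) <= t ->
  exists r, [/\ B r, star r = r, r * r = a, nm (Num.sqrt t *r e - r) <= Num.sqrt t &
    forall z, GRing.comm z e -> GRing.comm z a -> GRing.comm z r].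
Proof.
move=> Ba sa t0 ta; have [_ _ _ _ Be e1l e1r] := hB.
have [t_eq0|tn0] := eqVneq t 0.
  have a0 : a = 0.
    by apply: nm_eq0; move: ta; rewrite t_eq0 realZ0 sub0r nmN.
  exists 0; rewrite t_eq0 sqrtr0 realZ0 subrr nm0 star0 mulr0 a0; split => //.
  exact: (subalg0 hB).
have tp : 0 < t by rewrite lt_def tn0.
have [|||y [By sy y1 yE yC]] := @sqrt_iteration _ _ hB (e - t^-1 *r a).
- by apply: (subalgB hB) => //; exact: (subalgZ hB).
- by rewrite starB starZr sa (star_subalg_unit hB).
- rewrite -(ler_pM2l tp) mulr1 -nmZ_ge0// scalerBr realZA mulfV// realZ1 //.
exists (Num.sqrt t *r (e - y)); split.
- by apply: (subalgZ hB); apply: (subalgB hB).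
- by rewrite starZr starB sy (star_subalg_unit hB).
- rewrite cstarZl cstarZr realZA -expr2 sqr_sqrtr// mulrBl !mulrBr !e1l// e1r//.
  rewrite (_ : e - y - (y - y * y) = t^-1 *r a); first by rewrite realZA mulfV// realZ1.
  move/eqP: yE; rewrite -subr_eq => /eqP yE.
  by rewrite -[RHS](subKr e) -yE -addrA -opprD addrA.
- rewrite scalerBr opprB addrC subrK nmZ_ge0 ?sqrtr_ge0//.
  by rewrite ler_piMr ?sqrtr_ge0.
- move=> z ze za; rewrite /GRing.comm cstarZl cstarZr; congr (_ *: _).
  apply: commrB => //; apply: yC; apply: commrB => //.
  by rewrite /GRing.comm cstarZl cstarZr za.
Qed.

(** [t e - a = e (t - a) e], and [e] has norm at most one. *)
Lemma subalg_compress B e (hB : unital_cstar_subalgebra B e) a t :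
  B a -> nm (t *r (1 : A) - a) <= t -> nm (t *r e - a) <= t.
Proof.
move=> Ba ta; have [_ _ _ _ Be e1l e1r] := hB.
have -> : t *r e - a = e * (t *r (1 : A) - a) * e.
  by rewrite mulrBr mulrBl cstarZr cstarZl mulr1 e1l// e1l// e1r.
have e1 := nm_subalg_unit hB; have e0 := nm_ge0 e.
apply: le_trans (nmM _ _) _; have := nmM e (t *r (1 : A) - a).
have := nm_ge0 (t *r (1 : A) - a); have := nm_ge0 (e * (t *r (1 : A) - a)); nra.
Qed.

(** [u = h + i k] satisfies [star u * u = t], so [nm u ^+ 2 <= t], and [h] is the real part of
    [u]. *)
Lemma nm_le_sum_sqr h k t : 0 <= t -> star h = h -> star k = k -> GRing.comm h k ->
  h * h + k * k = t *r (1 : A) -> nm h ^+ 2 <= t.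
Proof.
move=> t0 sh sk hk hkt; pose u := h + 'i%C *: k.
have su : star u = h - 'i%C *: k by rewrite starD starZ sh sk conj_i scaleNr.
have uu : star u * u = t *r (1 : A).
  rewrite su mulrDr !mulrBl cstarZl !cstarZr hk addrA subrK cstarZl scalerA -hkt.
  by rewrite mulii scaleN1r opprK.
have u2 : nm u ^+ 2 <= t.
  by rewrite -nmC uu nmZ_ge0// ler_piMr// nm1.
have hhE : h + h = star u + u by rewrite su addrACA addNr addr0.
have : nm (2 *r h) <= 2 * nm u.
  by rewrite realZ2 hhE (le_trans (nmD _ _))// nm_star mulr_natl mulr2n.
rewrite nmZ_ge0// ler_pM2l// => hu; apply: le_trans u2.
by rewrite ler_sqr ?nnegrE ?nm_ge0.
Qed.

(** A square root [k] of [t - h^2] commutes with [h] and [h^2 + k^2 = t]; hence [nm k ^+ 2 <= t]. *)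
Lemma sqr_psd_le h t : star h = h -> nm h ^+ 2 <= t -> nm (t *r (1 : A) - h * h) <= t.
Proof.
move=> sh ht; have t0 : 0 <= t by rewrite (le_trans _ ht)// exprn_ge0// nm_ge0.
have [k [_ sk kE _ kC]] : exists k, [/\ [set: A] k, star k = k, k * k = t *r (1 : A) - h * h,
    nm (Num.sqrt t *r (1 : A) - k) <= Num.sqrt t &
    forall z, GRing.comm z (1 : A) -> GRing.comm z (t *r (1 : A) - h * h) -> GRing.comm z k].
  apply: (sqrt_core subalgT) => //.
    by rewrite starB starZr star1 star_mulC.
  by rewrite subKr nm_sqr.
rewrite -kE nm_sqr//; apply: (@nm_le_sum_sqr _ h) => //.
  apply/commr_sym/kC; first exact: commr1.
  apply: commrB; last by apply: commrM.
  by rewrite /GRing.comm cstarZl cstarZr mulr1 mul1r.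
by rewrite kE subrK.
Qed.

Lemma sqr_psd h : star h = h -> psd (h * h).
Proof.
move=> sh; split; first exact: star_mulC.
by exists (nm h ^+ 2); rewrite exprn_ge0 ?nm_ge0// sqr_psd_le.
Qed.

Lemma psd_sqrt B e (hB : unital_cstar_subalgebra B e) a : B a -> psd a ->
  exists r, [/\ B r, psd r, r * r = a &
    forall z, GRing.comm z e -> GRing.comm z a -> GRing.comm z r].
Proof.
move=> Ba [sa [t [t0 ta]]].
have [r [Br sr rE re rC]] := sqrt_core hB Ba sa t0 (subalg_compress hB Ba ta).
(* A second root shows that [r = q * q] is itself psd. *)
have [q [Bq sq qE _ _]] := sqrt_core hB Br sr (sqrtr_ge0 _) re.
by exists r; split => //; rewrite -qE; exact: sqr_psd.
Qed.

Lemma psd_sqrtT a : psd a ->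
  exists r, [/\ psd r, star r = r, r * r = a & forall z, GRing.comm z a -> GRing.comm z r].
Proof.
move=> pa; have [//|r [_ pr rE rC]] := psd_sqrt subalgT _ pa.
by exists r; split => //; [case: pr|move=> z; apply: rC; exact: commr1].
Qed.

(** The bound holds for every [t] above the norm, not only for the [t] that witnesses [psd a]. *)
Lemma psd_nm a t : psd a -> nm a <= t -> nm (t *r (1 : A) - a) <= t.
Proof.
move=> pa nat; have [r [pr sr rE _]] := psd_sqrtT pa.
by rewrite -rE sqr_psd_le// -nm_sqr// rE.
Qed.

Lemma psd0 : psd 0.
Proof. by split; [exact: star0|exists 0; rewrite realZ0 subrr nm0]. Qed.

Lemma psdD a b : psd a -> psd b -> psd (a + b).
Proof.
move=> [sa [t [t0 ta]]] [sb [s [s0 bs]]]; split; first by rewrite starD sa sb.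
exists (t + s); split; first exact: addr_ge0.
by rewrite realZDl opprD addrACA (le_trans (nmD _ _))// lerD.
Qed.

Lemma psdZ s a : 0 <= s -> psd a -> psd (s *r a).
Proof.
move=> s0 [sa [t [t0 ta]]]; split; first by rewrite starZr sa.
exists (s * t); split; first exact: mulr_ge0.
by rewrite -realZA -scalerBr nmZ_ge0// ler_wpM2l.
Qed.

(** The roots of commuting elements commute, so the product is the square of the self-adjoint
    [r * q]. *)
Lemma psdM a b : psd a -> psd b -> GRing.comm a b -> psd (a * b).
Proof.
move=> /psd_sqrtT[r [_ sr <- rC]] /psd_sqrtT[q [_ sq <- qC]] ab.
have /qC rq : GRing.comm r (q * q) by apply/commr_sym/rC/commr_sym.
rewrite (_ : _ * _ = (r * q) * (r * q)); first by apply/sqr_psd/star_mulC.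
by rewrite -!mulrA; congr (_ * _); rewrite !mulrA rq.
Qed.

Lemma psdB_nm h t : star h = h -> nm h <= t -> psd (t *r (1 : A) - h).
Proof.
move=> sh ht; split; first by rewrite starB starZr star1 sh.
by exists t; rewrite subKr ht (le_trans _ ht)// nm_ge0.
Qed.

Lemma psd_scalar t : 0 <= t -> psd (t *r (1 : A)).
Proof.
by move=> t0; have := @psdB_nm 0 t; rewrite subr0 nm0; apply => //; exact: star0.
Qed.

Lemma comm_scalar a t : GRing.comm a (t *r (1 : A)).
Proof. by rewrite /GRing.comm cstarZl cstarZr mulr1 mul1r. Qed.

(** [s^2 - a^2 = (s - a) (s + a)] is a product of commuting psd elements; its root [k] satisfies
    [a^2 + k^2 = s^2]. *)
Lemma nm_le_psd a s : star a = a -> 0 <= s ->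
  psd (s *r (1 : A) - a) -> psd (s *r (1 : A) + a) -> nm a <= s.
Proof.
move=> sa s0 pm pp; rewrite -ler_sqr ?nnegrE ?nm_ge0//.
have sC := comm_scalar a s.
have pc : psd (s ^+ 2 *r (1 : A) - a * a).
  rewrite (_ : _ - _ = (s *r (1 : A) - a) * (s *r (1 : A) + a)).
    apply: psdM => //; apply: commrD; first exact: comm_scalar.
    by apply/commr_sym/commrB.
  rewrite mulrDr !mulrBl sC addrA subrK; congr (_ - _).
  by rewrite cstarZl cstarZr realZA mulr1 expr2.
have [k [_ sk kE kC]] := psd_sqrtT pc.
apply: (@nm_le_sum_sqr _ k) => //; last 1 first.
- by rewrite kE addrC subrK.
- by rewrite exprn_ge0.
apply: kC; apply: commrB; first exact: comm_scalar.
exact: commrM.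
Qed.

Lemma psd_anti a : psd a -> psd (- a) -> a = 0.
Proof.
move=> pa pNa; apply: nm_eq0; apply: nm_le_psd; rewrite ?realZ0 ?add0r//.
by case: pa.
Qed.

(** The constant [nm a + 1] bounds the norm of every [a + s] with [0 < s <= 1], so one witness
    serves them all and survives [s -> 0]. *)
Lemma psd_closed a : (forall r, 0 < r -> psd (a + r *r (1 : A))) -> psd a.
Proof.
move=> H; split.
  have [+ _] := H 1 ltr01.
  by rewrite starD starZr star1 => /addIr.
exists (nm a + 1); split; first by rewrite addr_ge0// nm_ge0.
apply/ler_addgt0Pr => r r0; pose s := Num.min r 1.
have s0 : 0 < s by rewrite lt_min r0 ltr01.
have sr : s <= r by rewrite ge_min lexx.
have s1 : s <= 1 by rewrite ge_min lexx orbT.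
have nas : nm (a + s *r (1 : A)) <= nm a + 1.
  rewrite (le_trans (nmD _ _))// lerD2l nmZ_ge0 ?(ltW s0)//.
  by rewrite mulr_ile1 ?nm_ge0 ?nm1// ?ltW.
have := psd_nm (H s s0) nas.
set c := _ *r _; rewrite (_ : c - a = (c - (a + s *r (1 : A))) + s *r (1 : A)); last first.
  by rewrite opprD addrA subrK.
move=> h; rewrite (le_trans (nmD _ _))// lerD//.
by rewrite nmZ_ge0 ?(ltW s0)// (le_trans _ sr)// ler_piMr ?nm1// ltW.
Qed.

End Positivity.

(** * Agreement with the spectral definition, and absolute values *)

Section SpectralPositivity.
Context {R : realType} {A : unitalCStarAlgType R}.
Implicit Types (x y a b e h k : A) (s t : R) (B : set A).

Definition invertible a := exists y, y * a = 1 /\ a * y = 1.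

(** The iterates are the partial sums of the geometric series of [h], dominated by that of [t], with
    sum [(1 - t)^-1]. *)
Lemma neumann h t : nm h <= t -> t < 1 -> invertible (1 - h).
Proof.
move=> ht t1; have t0 : 0 <= t by rewrite (le_trans _ ht)// nm_ge0.
pose y n := iter n (fun y => 1 + h * y) 0.
pose s n := iter n (fun s : R => 1 + t * s) 0.
have yE n : y n.+1 = 1 + h * y n by [].
have sE n : s n.+1 = 1 + t * s n by [].
have yys n : nm (y n.+1 - y n) <= s n.+1 - s n.
  elim: n => [|n ih]; first by rewrite /= !mulr0 !addr0 !subr0 nm1.
  rewrite (yE n.+1) [X in _ - X](yE n) (sE n.+1) [in leRHS](sE n).
  rewrite opprD addrACA subrr add0r -mulrBr (le_trans (nmM _ _))//.
  rewrite opprD addrACA subrr add0r -mulrBr.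
  by rewrite ler_pM ?nm_ge0.
have s1 n : s n <= (1 - t)^-1.
  elim: n => [|n ih]; first by rewrite invr_ge0 subr_ge0 ltW.
  have tt : 0 < 1 - t by rewrite subr_gt0.
  have cE : (1 - t)^-1 = 1 + t * (1 - t)^-1 by field; rewrite gt_eqF.
  by rewrite sE cE lerD2l ler_wpM2l.
have [l yl] := dominated_cvg yys s1.
have hl : GRing.comm h l.
  have hy n : GRing.comm h (y n).
    elim: n => [|n ih]; first exact: commr0.
    by rewrite yE; apply: commrD; [exact: commr1|exact: commrM].
  apply/eqP; rewrite -subr_eq0; apply/eqP.
  apply: (cvg_bounded_eq0 (F := fun x => h * x - x * h) (K := nm h + nm h) _ yl).
  + by rewrite addr_ge0 ?nm_ge0.
  + by move=> a b; rewrite mulrBr mulrBl !opprD !opprK addrACA.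
  + move=> a; rewrite (le_trans (nmB _ _))// [leRHS]mulrDl lerD ?nmM//.
    by rewrite mulrC nmM.
  + by move=> n; rewrite hy subrr.
have lE : (1 - h) * l = 1.
  apply/eqP; rewrite -subr_eq0; apply/eqP/nm_lt0 => r r0.
  have r20 : 0 < r / 2 by rewrite divr_gt0.
  have [n [yn yn1]] := cvg_nm_lt yl r20.
  rewrite (_ : _ - 1 = (l - y n.+1) + h * (y n - l)); last first.
    by rewrite yE mulrBl mul1r mulrBr opprD !addrA subrK addrAC.
  rewrite (le_trans (nmD _ _))// [leRHS]splitr lerD//; first by rewrite nmBC ltW.
  rewrite (le_trans (nmM _ _))// (le_trans _ (ltW yn))//.
  by rewrite ler_piMl ?nm_ge0// (le_trans ht)// ltW.
exists l; split=> //.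
by rewrite -[RHS]lE mulrBl mulrBr mulr1 mul1r hl.
Qed.

Lemma invertibleZ (c : R[i]) a : c != 0 -> invertible a -> invertible (c *: a).
Proof.
move=> c0 [y [ya ay]]; exists (c^-1 *: y).
by rewrite !cstarZl !cstarZr ya ay !scalerA mulfV ?mulVf// scale1r.
Qed.

Lemma invertible_psd a t : psd a -> 0 < t -> invertible (a + t *r (1 : A)).
Proof.
move=> [sa [s [s0 sat]]] t0; have st : 0 < s + t by rewrite ltr_wpDl.
have -> : a + t *r (1 : A) = (s + t) *r (1 - (s + t)^-1 *r (s *r (1 : A) - a)).
  rewrite scalerBr realZA mulfV ?gt_eqF// realZ1 realZDl opprB.
  by rewrite [RHS]addrC addrA subrK.
apply: invertibleZ.
  by apply/eqP => -[/eqP]; rewrite gt_eqF.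
apply: (@neumann _ (s / (s + t))).
  by rewrite nmZ_ge0 ?invr_ge0 ?(ltW st)// mulrC ler_pM2r ?invr_gt0.
by rewrite ltr_pdivrMr// mul1r ltrDl.
Qed.

(* If [t0] is the least [t >= 0] with [a + t] psd and [t0 > 0], then [a + t0] is
   psd and invertible, hence bounded below by some [d > 0], contradicting the
   minimality of [t0]. *)
Lemma psd_invertible a : star a = a ->
  (forall t, 0 < t -> invertible (a + t *r (1 : A))) -> psd a.
Proof.
move=> sa inv; apply: contrapT => npa.
pose S := [set t : R | psd (a + t *r (1 : A))].
have S0 t : S t -> 0 <= t.
  move=> St; rewrite leNgt; apply/negP => t0; apply: npa.
  rewrite -[a](addrK (t *r (1 : A))) -realZNl; apply: psdD => //.
  by apply: psd_scalar; rewrite oppr_ge0 ltW.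
have Sup t s : S t -> t <= s -> S s.
  move=> St ts; rewrite /S/= -(subrK t s) realZDl addrCA addrC addrC.
  by apply: psdD => //; apply: psd_scalar; rewrite subr_ge0.
have hS : has_inf S.
  split; last by exists 0 => t; exact: S0.
  exists (nm a); rewrite /S/= addrC -{2}[a]opprK; apply: psdB_nm; rewrite ?nmN//.
  by rewrite starN sa.
have t00 : 0 <= inf S by apply: lb_le_inf; [case: hS|move=> t; exact: S0].
have St0 : S (inf S).
  apply: psd_closed => r r0; rewrite -addrA -realZDl.
  have [s Ss sr] := inf_adherent r0 hS.
  by apply: Sup Ss (ltW _).
have [t0E|t0n] := eqVneq (inf S) 0.
  by apply: npa; move: St0; rewrite t0E /S/= realZ0 addr0.
have t0p : 0 < inf S by rewrite lt_def t0n.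
have [w [wc cw]] := inv _ t0p; set c := a + _ in wc cw St0.
have sc : star c = c by case: St0.
have sw : star w = w.
  have h : star w * c = 1 by rewrite -{1}sc -star_mul cw star1.
  by rewrite -[LHS]mulr1 -cw mulrA h mul1r.
(* [M] exceeds the norm of the inverse [w], so [c - M^-1 = M^-1 c (M - w)] is a product of commuting
   psd elements. *)
pose M := nm w + 1; have M0 : 0 < M by rewrite ltr_wpDl ?nm_ge0.
have pMw : psd (M *r (1 : A) - w) by apply: psdB_nm => //; rewrite lerDl.
have cM : GRing.comm c (M *r (1 : A) - w).
  by apply: commrB; [exact: comm_scalar|rewrite /GRing.comm cw wc].
have : S (inf S - M^-1).
  rewrite /S/= realZBl addrA -/c.
  have -> : c - M^-1 *r (1 : A) = M^-1 *r (c * (M *r (1 : A) - w)).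
    by rewrite mulrBr cw cstarZr mulr1 scalerBr realZA mulVf ?gt_eqF// realZ1.
  by apply: psdZ; [rewrite invr_ge0 ltW|exact: psdM].
have [_ lbS] := hS.
move=> /(ge_inf lbS); rewrite lerBrDr gerDl leNgt invr_gt0 M0 //.
Qed.

Lemma invertible_inv a y z : y * a = 1 -> a * z = 1 -> invertible a.
Proof.
move=> ya az; suff yz : y = z by exists y; split; rewrite // yz.
by rewrite -[y]mulr1 -az mulrA ya mul1r.
Qed.

Lemma invertible_commMl a b : GRing.comm a b -> invertible (a * b) -> invertible a.
Proof.
move=> ab [w [h1 h2]]; apply: (@invertible_inv a (w * b) (b * w)).
  by rewrite -mulrA -ab.
by rewrite mulrA.
Qed.

Lemma cstar_posP a : cstar_pos a <-> psd a.
Proof.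
split=> [[sa sp]|pa].
  apply: psd_invertible => // t t0; apply: contrapT => ninv.
  have /sp : spectrum a (- t)%:C.
    by move=> inv; apply: ninv; move: inv; rewrite realZNl opprK.
  by rewrite /= ler0c oppr_ge0 leNgt t0.
have sa : star a = a by case: pa.
split => // l lsp /=; apply: contrapT => l0; apply: lsp; move: l l0 => [u v] l0.
have [v0|v0] := eqVneq v 0.
  have u0 : 0 < - u.
    by move/negP: l0; rewrite v0 complexr0 ler0c -ltNge oppr_gt0.
  by have := invertible_psd pa u0; rewrite realZNl v0 complexr0.
have sau : star (a - u *r (1 : A)) = a - u *r (1 : A).
  by rewrite starB starZr star1 sa.
have v2 : 0 < v ^+ 2 by rewrite exprn_even_gt0.
(* For [v != 0] and [q = a - u], the invertible [q^2 + v^2] factors as [(q - c) (q + c)] with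
   commuting factors; so [q - c], which is [a - (u + i v)], is invertible. *)
pose c : A := (v *i)%C *: (1 : A).
have cE : v ^+ 2 *r (1 : A) = - (c * c).
  rewrite cstarZl cstarZr mulr1 scalerA -scaleNr; congr (_ *: _).
  by apply/eqP; rewrite eq_complex/=; apply/andP; split; apply/eqP; ring.
have lE : (u +i* v)%C *: (1 : A) = u *r (1 : A) + c.
  rewrite -scalerDl; congr (_ *: _).
  by apply/eqP; rewrite eq_complex/= addr0 add0r !eqxx.
set q := a - u *r (1 : A) in sau.
have qc : GRing.comm q c by rewrite /GRing.comm cstarZl cstarZr mulr1 mul1r.
have := invertible_psd (sqr_psd sau) v2; rewrite cE.
rewrite /= lE opprD addrA -/q; move: q c qc {sau cE lE} => q c qc.
rewrite (_ : q * q - c * c = (q - c) * (q + c)); last first.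
  by rewrite mulrDr !mulrBl qc addrA subrK.
apply: invertible_commMl.
by apply: commrD; apply/commr_sym/commrB.
Qed.

(** Away from zero, [x y] and [y x] have the same spectrum: an inverse [w] of [y x + t] yields the
    inverse [(1 - x w y) / t] of [x y + t]. *)
Lemma invertible_swap x y t : t != 0 ->
  invertible (y * x + t *r (1 : A)) -> invertible (x * y + t *r (1 : A)).
Proof.
move=> t0 [w [h1 h2]]; exists (t^-1 *r (1 - x * w * y)).
have h1' : w * y * x = 1 - t *r w.
  by move: h1; rewrite mulrDr cstarZr mulr1 mulrA => <-; rewrite addrK.
have h2' : y * x * w = 1 - t *r w.
  by move: h2; rewrite mulrDl cstarZl mul1r => <-; rewrite addrK.
split; rewrite ?cstarZl ?cstarZr.
  rewrite mulrBl mul1r mulrDr cstarZr mulr1.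
  rewrite (_ : x * w * y * (x * y) = x * (w * y * x) * y); last by rewrite !mulrA.
  rewrite h1' mulrBr mulr1 mulrBl cstarZr cstarZl subrK [x * y + _]addrC addrK.
  by rewrite realZA mulVf// realZ1.
rewrite mulrBr mulr1 mulrDl cstarZl mul1r.
rewrite (_ : x * y * (x * w * y) = x * (y * x * w) * y); last by rewrite !mulrA.
rewrite h2' mulrBr mulr1 mulrBl cstarZr cstarZl subrK [x * y + _]addrC addrK.
by rewrite realZA mulVf// realZ1.
Qed.

Lemma psd_swapN x : psd (- (star x * x)) -> psd (- (x * star x)).
Proof.
move=> px; apply: psd_invertible => [|t t0].
  by rewrite starN star_mul starK.
have := invertible_psd px t0; rewrite -mulNr -mulrN.
apply: invertible_swap; exact: lt0r_neq0.
Qed.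

(** The sum is [(p^2 + q^2) / 2], with [p] and [q] real multiples of the real and imaginary parts of
    [x]. *)
Lemma psd_star_add x : psd (star x * x + x * star x).
Proof.
pose p := x + star x; pose q := 'i%C *: (x - star x).
have sp : star p = p by rewrite starD starK addrC.
have sq : star q = q by rewrite starZ starB starK conj_i scaleNr -scalerN opprB.
have := psdZ (_ : 0 <= 2^-1) (psdD (sqr_psd sp) (sqr_psd sq)).
rewrite invr_ge0 ler0n => /(_ isT).
rewrite (_ : p * p + q * q = 2 *r (star x * x + x * star x)) ?realZA ?mulVf ?realZ1//.
rewrite cstarZl cstarZr scalerA mulii scaleN1r realZ2 /p {sp sq p q}.
move: (star x) => y; rewrite mulrDl mulrBl opprD opprK addrACA -mulrBr -mulrDr.
have -> : x + y - (x - y) = y + y by rewrite opprB addrC addrA subrK.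
by rewrite addrACA subrr addr0 !mulrDr addrACA [y * x + _]addrC.
Qed.

Lemma selfadjoint_cube0 h : star h = h -> h * h * h = 0 -> h = 0.
Proof.
move=> sh h3; have : nm (h * h) ^+ 2 = 0.
  by rewrite -nm_sqr ?star_mulC// mulrA h3 mul0r nm0.
by move/eqP; rewrite nm_sqr// !expf_eq0/= => /eqP h0; apply: nm_eq0; rewrite h0.
Qed.

(* With [r = (a^2)^(1/2)] for [a = star x * x] and [u = r - a], the element
   [z = x u] satisfies [star z * z = - u r u], so both [- star z * z] and
   [- z * star z] are psd while their sum is the opposite of a psd element. *)
Lemma psd_starM x : psd (star x * x).
Proof.
pose a := star x * x; have sa : star a = a by rewrite star_mul starK.
have [r [pr sr rE rC]] := psd_sqrtT (sqr_psd sa).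
have ar : GRing.comm a r by apply: rC; exact: commrM.
pose u := r - a; have su : star u = u by rewrite starB sr sa.
have ur : GRing.comm u r by apply/commr_sym/commrB => //; exact/commr_sym.
have uau : u * a = - (u * r).
  by rewrite !mulrBl -rE ar opprB.
pose z := x * u.
have zz : star z * z = - (u * u * r).
  have -> : star z * z = u * a * u by rewrite star_mul su !mulrA.
  by rewrite uau mulNr -(mulrA u r) -ur mulrA.
have pNzz : psd (- (star z * z)).
  by rewrite zz opprK; apply: psdM (sqr_psd su) pr _; apply/commr_sym/commrM; exact/commr_sym.
have zz0 : z * star z = 0.
  apply: psd_anti (psd_swapN pNzz).
  by rewrite -[X in psd X](addKr (star z * z)); apply: psdD => //; exact: psd_star_add.
have z0 : z = 0.
  apply: nm_eq0; rewrite -nm_star -(@ler_pXn2r _ 2) ?nnegrE ?nm_ge0//.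
  by rewrite -nmC starK zz0 nm0 expr0n.
have uur : u * u * r = 0 by rewrite -[LHS]opprK -zz z0 mulr0 oppr0.
(* Since [u a = - u r], both terms of [u^3 = u^2 r - u^2 a] vanish. *)
have u0 : u = 0.
  apply: selfadjoint_cube0 => //; rewrite {3}/u mulrBr uur -mulrA uau.
  by rewrite mulrN mulrA uur !oppr0 addr0.
by move/subr0_eq: u0 => ra; rewrite -/a -ra.
Qed.

(** It suffices to compare [b] with a root [r] commuting with all that commutes with [a]. For
    [d = b - r], the psd elements [d^2 b] and [d^2 r] have sum zero; so both vanish, and
    [d^3 = 0]. *)
Lemma psd_sqrt_uniq b c : psd b -> psd c -> b * b = c * c -> b = c.
Proof.
suff H a : forall r, psd r -> r * r = a -> (forall z, GRing.comm z a -> GRing.comm z r) ->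
    forall b, psd b -> b * b = a -> b = r.
  move=> pb pc bc; have [r [pr _ rE rC]] := psd_sqrtT (sqr_psd (proj1 pb)).
  by rewrite (H _ r pr rE rC b)// (H _ r pr rE rC c).
move=> r pr rE rC {}b {}pb bE; have br : GRing.comm b r by apply: rC; rewrite -bE; exact: commrM.
apply/eqP; rewrite -subr_eq0; apply/eqP; set d := b - r.
have sd : star d = d by rewrite starB (proj1 pb) (proj1 pr).
have db : GRing.comm b d by apply: commrB => //; exact/commr_sym.
have dr : GRing.comm r d by apply: commrB => //; exact/commr_sym.
have pdb : psd (d * d * b) by apply: psdM (sqr_psd sd) pb _; exact/commr_sym/commrM.
have pdr : psd (d * d * r) by apply: psdM (sqr_psd sd) pr _; exact/commr_sym/commrM.
have dbr : d * b + d * r = 0.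
  by rewrite !mulrBl bE rE br addrA subrK subrr.
have ddb : d * d * b = - (d * d * r).
  by apply/eqP; rewrite -addr_eq0 -!mulrA -mulrDr dbr mulr0.
have ddr : d * d * r = 0 by apply: psd_anti => //; rewrite -ddb.
by apply: selfadjoint_cube0 => //; rewrite {3}/d mulrBr ddb ddr oppr0 addr0.
Qed.

Lemma cstar_abs_eq x b : psd b -> b * b = star x * x -> cstar_abs x = b.
Proof.
move=> pb bE; rewrite /cstar_abs /cstar_sqrt; case: xgetP => [c _ [/cstar_posP pc cE]|/(_ b)].
  by apply: psd_sqrt_uniq => //; rewrite bE.
by case; split => //; exact/cstar_posP.
Qed.

(** The absolute value is formed in [A], yet lies in [B]: a psd root exists in [B], and psd roots
    are unique in [A]. *)
Lemma cstar_absP B e (hB : unital_cstar_subalgebra B e) x : B x ->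
  [/\ B (cstar_abs x), psd (cstar_abs x) & cstar_abs x * cstar_abs x = star x * x].
Proof.
move=> Bx; have [_ Bmul Bstar _ _ _ _] := hB.
have [|r [Br pr rE _]] := psd_sqrt hB _ (psd_starM x).
  by apply: Bmul => //; exact: Bstar.
by rewrite (cstar_abs_eq pr rE).
Qed.

End SpectralPositivity.

(** * Extreme dominated functionals *)

Section ExtremeFunctional.
Context {R : realType} {V : lmodType R[i]} (W : set V).
Hypothesis Wlin : forall (s : R) x y, W x -> W y -> W (s *r x + y).
Hypothesis W0 : W 0.
Implicit Types (x y b : V) (s t u : R) (G : set (V * R)) (f g h : V -> R).

Definition real_linear_on f := forall s x y, W x -> W y -> f (s *r x + y) = s * f x + f y.

Definition dominated G f := forall x t, G (x, t) -> f x <= t.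

(* The pairs [(x, t)] with [p x < t], for a real sublinear functional [p] on [W],
   form such a cone; conversely it defines [p x := inf {t | G (x, t)}]. *)
Record sublinear_cone G : Prop := {
  cone_sub : forall x t, G (x, t) -> W x ;
  coneD : forall x y t u, G (x, t) -> G (y, u) -> G (x + y, t + u) ;
  coneZ : forall s x t, 0 < s -> G (x, t) -> G (s *r x, s * t) ;
  cone_total : forall x, W x -> exists t, G (x, t) ;
  cone_ge0 : forall t, G (0, t) -> 0 <= t
}.

Definition cone_inf G x : R := inf [set t | G (x, t)].

Let WZ s x : W x -> W (s *r x).
Proof. by move=> Wx; rewrite -[_ *: _]addr0; exact: Wlin. Qed.

Let WD x y : W x -> W y -> W (x + y).
Proof. by move=> Wx Wy; rewrite -[x]realZ1; exact: Wlin. Qed.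

Let WN x : W x -> W (- x).
Proof. by move=> Wx; rewrite -[x]realZ1 -realZNl; exact: WZ. Qed.

Lemma cone_inf_le G x t : sublinear_cone G -> G (x, t) -> cone_inf G x <= t.
Proof.
move=> [sub D _ tot ge0] Gx; apply: ge_inf => //.
(* The infimum needs a lower bound: adding [(- x, s)] to [(x, u)] gives [0 <= s + u]. *)
have [s Gs] := tot _ (WN (sub _ _ Gx)).
exists (- s) => u /= Gu; rewrite -subr_ge0 opprK; apply: ge0.
by rewrite -(subrr x); exact: D.
Qed.

Lemma cone_inf_ge G x u : sublinear_cone G -> W x -> (forall t, G (x, t) -> u <= t) ->
  u <= cone_inf G x.
Proof. by move=> [_ _ _ tot _] Wx H; apply: lb_le_inf => //; exact: tot. Qed.

Lemma dominated_inf G f x : sublinear_cone G -> dominated G f -> W x -> f x <= cone_inf G x.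
Proof. by move=> cG fG Wx; apply: cone_inf_ge => // t; exact: fG. Qed.

(** [(0, 0)] need not belong to [G], as in a strict epigraph; scaling some [(0, t)] comes
    arbitrarily close. *)
Lemma cone0_eps G s : sublinear_cone G -> 0 < s -> exists t, t <= s /\ G (0, t).
Proof.
move=> [_ _ Z tot ge0] s0; have [t Gt] := tot _ W0.
have t0 := ge0 _ Gt; have t1 : 0 < t + 1 by rewrite ltr_wpDl.
exists (s / (t + 1) * t); split.
  by rewrite mulrAC ler_pdivrMr// ler_wpM2l ?lerDl// ltW.
by rewrite -(scaler0 _ (s / (t + 1))%:C); apply: Z => //; rewrite divr_gt0.
Qed.

(* The cone of the sublinear functional whose dominated linear functionals are
   those [f <= p] with [f b = p b]. *)
Definition exposed G b : set (V * R) :=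
  [set z | exists s, [/\ 0 <= s & G (z.1 + s *r b, z.2 + s * cone_inf G b)]].

Lemma sub_exposed G b : G `<=` exposed G b.
Proof. by move=> [x t] Gx; exists 0; rewrite realZ0 mul0r !addr0. Qed.

Lemma exposed_cone G b : sublinear_cone G -> W b -> sublinear_cone (exposed G b).
Proof.
move=> cG Wb; have [sub D Z tot ge0] := cG; split.
- move=> x t [s [_ /sub/= h]]; rewrite -[x](addrK (s *r b)).
  by apply: WD => //; apply/WN/WZ.
- move=> x y t u [s [s0 /= Gx]] [s' [s0' /= Gy]].
  exists (s + s'); rewrite addr_ge0//=; split=> //.
  by rewrite realZDl mulrDl addrACA [t + u + _]addrACA; exact: D.
- move=> s x t s0 [s' [s0' /= Gx]]; exists (s * s'); rewrite mulr_ge0 ?(ltW s0)//=; split=> //.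
  by rewrite -realZA -scalerDr -mulrA -mulrDr; exact: Z.
- by move=> x /tot[t Gt]; exists t; exact: sub_exposed.
- move=> t [s [s0 /=]]; rewrite add0r; have [->|sn0] := eqVneq s 0.
    by rewrite realZ0 mul0r addr0; exact: ge0.
  (* Division by [s] gives [G (b, s^-1 t + p b)] with [p = cone_inf G], whence
     [p b <= s^-1 t + p b]. *)
  have sp : 0 < s by rewrite lt_def sn0.
  move=> Gs; have si : 0 < s^-1 by rewrite invr_gt0.
  have := Z _ _ _ si Gs; rewrite realZA mulVf// realZ1 => /(cone_inf_le cG).
  by rewrite mulrDr mulKf// lerDr pmulr_rge0.
Qed.

(** This forces the value at [b]: a linear [f] dominated by [exposed G b] has
    [- f b <= - cone_inf G b]. *)
Lemma exposed_inf G b : sublinear_cone G -> W b ->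
  cone_inf (exposed G b) (- b) <= - cone_inf G b.
Proof.
move=> cG Wb; apply/ler_addgt0Pr => s s0; have [t [ts Gt]] := cone0_eps cG s0.
apply: le_trans (_ : - cone_inf G b + t <= _); last by rewrite lerD2l.
apply: (cone_inf_le (exposed_cone cG Wb)); exists 1; rewrite ler01; split=> //=.
by rewrite realZ1 addNr mul1r addrAC addNr add0r.
Qed.

(** The extremality condition for the functionals dominated by [G] within the convex set of those
    dominated by [G0]. *)
Definition face G0 G := forall s g h, 0 < s < 1 -> real_linear_on g -> real_linear_on h ->
  dominated G0 g -> dominated G0 h ->
  dominated G (fun x => s * g x + (1 - s) * h x) -> dominated G g /\ dominated G h.

Lemma real_linear0 f : real_linear_on f -> f 0 = 0.
Proof.
move=> lf; have := lf 1 0 0 W0 W0; rewrite realZ1 addr0 mul1r => /eqP.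
by rewrite eq_sym -subr_eq0 addrK => /eqP.
Qed.

Lemma real_linearN f x : real_linear_on f -> W x -> f (- x) = - f x.
Proof.
move=> lf Wx; have f0 := real_linear0 lf.
by have := lf (-1) x 0 Wx W0; rewrite realZNl realZ1 addr0 f0 addr0 mulN1r.
Qed.

Lemma real_linearD f x y : real_linear_on f -> W x -> W y -> f (x + y) = f x + f y.
Proof. by move=> lf Wx Wy; rewrite -[x in LHS]realZ1 lf// mul1r. Qed.

Lemma real_linearZ f s x : real_linear_on f -> W x -> f (s *r x) = s * f x.
Proof.
move=> lf Wx; rewrite -[_ *: _]addr0 lf//.
by rewrite real_linear0// addr0.
Qed.

Lemma exposed_face G0 G b : sublinear_cone G -> W b -> face G0 G -> face G0 (exposed G b).
Proof.
move=> cG Wb fG s g h s01 lg lh g0 h0 dom.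
have [|gG hG] := fG s g h s01 lg lh g0 h0.
  by move=> x t Gx; apply: dom; exact: sub_exposed.
have gb := dominated_inf cG gG Wb; have hb := dominated_inf cG hG Wb.
have := dominated_inf (exposed_cone cG Wb) dom (WN Wb).
move=> /le_trans/(_ (exposed_inf cG Wb)); rewrite !real_linearN// => le_b.
(* Both values are at most [cone_inf G b], while a proper convex combination of them is at least
   that. *)
have [gE hE] : g b = cone_inf G b /\ h b = cone_inf G b.
  move: s01 gb hb le_b => /andP[s0 s1] gb hb le_b; split; nra.
split=> x t [u [u0 /= Gx]]; have Wx : W x.
- by have [sub _ _ _ _] := exposed_cone cG Wb; apply: (sub x t); exists u.
- have := gG _ _ Gx; rewrite real_linearD// ?real_linearZ//; last exact: WZ.
  by rewrite gE lerD2r.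
- by have [sub _ _ _ _] := exposed_cone cG Wb; apply: (sub x t); exists u.
- have := hG _ _ Gx; rewrite real_linearD// ?real_linearZ//; last exact: WZ.
  by rewrite hE lerD2r.
Qed.

(** A sublinear functional that is odd is linear: subadditivity at the opposites gives the reverse
    inequality. *)
Lemma cone_inf_linear G : sublinear_cone G ->
  (forall b, W b -> cone_inf G (- b) <= - cone_inf G b) -> real_linear_on (cone_inf G).
Proof.
move=> cG N; have [sub D Z tot ge0] := cG; set p := cone_inf G.
have pD x y : W x -> W y -> p (x + y) <= p x + p y.
  move=> Wx Wy; rewrite -lerBlDr; apply: cone_inf_ge => // t Gt.
  rewrite lerBlDr -lerBlDl; apply: cone_inf_ge => // u Gu.
  by rewrite lerBlDl (cone_inf_le cG)//; exact: D.
have pZ s x : 0 < s -> W x -> p (s *r x) <= s * p x.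
  move=> s0 Wx; rewrite -ler_pdivrMl//; apply: cone_inf_ge => // t Gt.
  by rewrite ler_pdivrMl//; apply: (cone_inf_le cG); exact: Z.
have p0 : 0 <= p 0 by apply: (cone_inf_ge cG W0) => t; exact: ge0.
have pN x : W x -> p (- x) = - p x.
  move=> Wx; apply/eqP; rewrite eq_le N//= -subr_ge0 opprK (le_trans p0)//.
  by rewrite -(addNr x) pD//; exact: WN.
have pDE x y : W x -> W y -> p (x + y) = p x + p y.
  move=> Wx Wy; apply/eqP; rewrite eq_le pD//= -lerN2 -pN; last exact: WD.
  by rewrite !opprD -!pN// pD//; exact: WN.
have pZE s x : 0 < s -> W x -> p (s *r x) = s * p x.
  move=> s0 Wx; apply/eqP; rewrite eq_le pZ//=.
  have := pZ s^-1 (s *r x); rewrite invr_gt0 realZA mulVf ?gt_eqF// realZ1.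
  by move=> /(_ s0 (WZ _ Wx)); rewrite ler_pdivlMl.
have p00 : p 0 = 0.
  by apply: (@addrI _ (p 0)); rewrite -pDE// !addr0.
move=> s x y Wx Wy; rewrite pDE//; last exact: WZ.
congr (_ + _); have [s0|s0|->] := ltgtP s 0; last by rewrite realZ0 mul0r p00.
  by rewrite -[s]opprK realZNl pN ?pZE ?oppr_gt0 ?mulNr//; exact: WZ.
exact: pZE.
Qed.

(* A lexicographically maximal functional: Zorn's lemma gives a face of the set of
   dominated functionals on which no element of [W] takes two values. *)
Theorem extreme_dominated G0 b : sublinear_cone G0 -> W b ->
  exists f, [/\ real_linear_on f, dominated G0 f, f b = cone_inf G0 b &
    forall s g h, 0 < s < 1 -> real_linear_on g -> real_linear_on h ->
      dominated G0 g -> dominated G0 h ->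
      (forall x, W x -> f x = s * g x + (1 - s) * h x) ->
      forall x, W x -> g x = f x /\ h x = f x].
Proof.
move=> cG0 Wb; pose G1 := exposed G0 b.
pose good G := sublinear_cone G /\ face G0 G.
have goodE G c : W c -> good G -> good (exposed G c).
  by move=> Wc [cG fG]; split; [exact: exposed_cone|exact: exposed_face].
have good1 : good G1 by apply: goodE => //; split=> //.
(* Adjoining [G1] fixes the value at [b] throughout and covers the empty chain. *)
pose P X := good (X `|` G1).
have PU F : F `<=` P -> total_on F subset -> P (\bigcup_(X in F) X).
  move=> FP Ftot; rewrite /P; set U := _ `|` _.
  have U1 z : U z -> exists G, [/\ good G, G `<=` U & G z].
    move=> [[X FX Xz]|Gz]; last by exists G1; split=> //; right.
    exists (X `|` G1); split; [exact: FP| |by left].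
    by move=> w [Xw|Gw]; [left; exists X|right].
  have U2 z w : U z -> U w -> exists G, [/\ good G, G `<=` U, G z & G w].
    move=> [[X FX Xz]|Gz] [[Y FY Yw]|Gw].
    - have [XY|YX] := Ftot _ _ FX FY.
      + exists (Y `|` G1); split; [exact: FP| |by left; apply: XY|by left].
        by move=> v [Yv|Gv]; [left; exists Y|right].
      + exists (X `|` G1); split; [exact: FP| |by left|by left; apply: YX].
        by move=> v [Xv|Gv]; [left; exists X|right].
    - exists (X `|` G1); split; [exact: FP| |by left|by right].
      by move=> v [Xv|Gv]; [left; exists X|right].
    - exists (Y `|` G1); split; [exact: FP| |by right|by left].
      by move=> v [Yv|Gv]; [left; exists Y|right].
    - by exists G1; split=> // v; right.
  split; first split.
  - by move=> x t /U1[G [[[sub _ _ _ _] _] _ /sub]].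
  - by move=> x y t u Ux Uy; have [G [[[_ D _ _ _] _] GU Gx Gy]] := U2 _ _ Ux Uy; apply/GU/D.
  - by move=> s x t s0 /U1[G [[[_ _ Z _ _] _] GU Gx]]; apply/GU/Z.
  - by move=> x; have [[_ _ _ tot _] _] := good1 => /tot[t Gt]; exists t; right.
  - by move=> t /U1[G [[[_ _ _ _ ge0] _] _ /ge0]].
  - move=> s g h s01 lg lh g0 h0 dom; split=> x t /U1[G [[_ fG] GU Gx]].
      have [|gG _] := fG s g h s01 lg lh g0 h0; last exact: gG.
      by move=> y u Gy; apply/dom/GU.
    have [|_ hG] := fG s g h s01 lg lh g0 h0; last exact: hG.
    by move=> y u Gy; apply/dom/GU.
have [X [PX maxX]] := Zorn_bigcup PU.
pose G := X `|` G1; have [cG fG] : good G := PX.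
(* By maximality, exposing at any [c] adds nothing to [G]; with [exposed_inf] this makes
   [cone_inf G] odd. *)
have exG c : W c -> exposed G c `<=` G.
  move=> Wc z ez; left; apply: contrapT => Xz.
  apply: (maxX (exposed G c)).
    split; first by move=> w Xw; apply: sub_exposed; left.
    by move=> /(_ _ ez).
  rewrite /P setUidl; first exact: goodE.
  by move=> w Gw; apply: sub_exposed; right.
have N c : W c -> cone_inf G (- c) <= - cone_inf G c.
  move=> Wc; apply: le_trans (exposed_inf cG Wc).
  apply: cone_inf_ge; [exact: exposed_cone|exact: WN|].
  by move=> t /(exG _ Wc)/(cone_inf_le cG).
have lf := cone_inf_linear cG N.
have dG1 : dominated G1 (cone_inf G) by move=> x t Gx; apply: cone_inf_le => //; right.
have dG0 : dominated G0 (cone_inf G).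
  by move=> x t Gx; apply: dG1; exact: sub_exposed.
exists (cone_inf G); split=> //.
  apply/eqP; rewrite eq_le (dominated_inf cG0 dG0 Wb)/= -lerN2 -(real_linearN lf Wb).
  apply: le_trans (exposed_inf cG0 Wb).
  apply: dominated_inf => //; [exact: exposed_cone|exact: WN].
move=> s g h s01 lg lh g0 h0 fE.
have [|gG hG] := fG s g h s01 lg lh g0 h0.
  move=> x t Gx; rewrite -fE; first exact: cone_inf_le.
  by case: cG => sub _ _ _ _; exact: sub Gx.
(* Domination at both [x] and [- x] is equality, because [cone_inf G] is linear. *)
have eqf k : real_linear_on k -> dominated G k -> forall x, W x -> k x = cone_inf G x.
  move=> lk kG x Wx; apply/eqP; rewrite eq_le dominated_inf//= -lerN2.
  by rewrite -(real_linearN lf)// -(real_linearN lk)// dominated_inf//; exact: WN.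
by move=> x Wx; split; exact: eqf.
Qed.

End ExtremeFunctional.

(** * States *)

Section ComplexNumbers.
Context {R : realType}.
Implicit Types (z w : R[i]) (t : R).

Lemma ReD z w : complex.Re (z + w) = complex.Re z + complex.Re w.
Proof. by case: z; case: w. Qed.

Lemma ReN z : complex.Re (- z) = - complex.Re z.
Proof. by case: z. Qed.

Lemma ReZ t z : complex.Re (t%:C * z) = t * complex.Re z.
Proof. by case: z => u v /=; rewrite mul0r subr0. Qed.

Lemma Re_ge0 z : 0 <= z -> 0 <= complex.Re z.
Proof. by rewrite lecE => /andP[]. Qed.

Lemma ge0_ReE z : 0 <= z -> z = (complex.Re z)%:C.
Proof. by move=> z0; rewrite RRe_real// ger0_real. Qed.

Lemma unimodular_Re z : exists c : R[i], complex.Re `|c| = 1 /\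
  complex.Re (c * z) = complex.Re `|z|.
Proof.
have [->|z0] := eqVneq z 0; first by exists 1; rewrite normr1 mulr0 normr0.
have nz : `|z| != 0 by rewrite normr_eq0.
exists (`|z| / z); rewrite mulfVK//; split=> //.
by rewrite normrM normfV normr_id mulfV.
Qed.

End ComplexNumbers.

Section States.
Context {R : realType} {A : unitalCStarAlgType R} {B : set A} {e : A}.
Hypothesis hB : unital_cstar_subalgebra B e.
Implicit Types (x y a b h : A) (s t u : R) (phi psi : A -> R[i]).

Let Be : B e. Proof. by case: hB. Qed.
Let Bstar x : B x -> B (star x). Proof. by case: hB => _ _ + _ _ _ _; exact. Qed.
Let se : star e = e. Proof. exact: star_subalg_unit hB. Qed.
Let e1l x : B x -> e * x = x. Proof. by case: hB => _ _ _ _ _ + _; exact. Qed.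
Let e1r x : B x -> x * e = x. Proof. by case: hB => _ _ _ _ _ _; exact. Qed.

Lemma subalg_real_linear s x y : B x -> B y -> B (s *r x + y).
Proof. by case: hB => lin _ _ _ _ _ _; exact: lin. Qed.

Lemma psd_compress a : psd a -> psd (e * a * e).
Proof.
move=> /psd_sqrtT[q [_ sq <- _]].
by have := psd_starM (q * e); rewrite star_mul se sq !mulrA.
Qed.

Lemma psd_unit : psd e.
Proof. by have := psd_starM e; rewrite se e1l. Qed.

Lemma psd_unit_compl : psd (1 - e).
Proof.
have := psd_starM (1 - e); rewrite starB star1 se mulrBr mulr1 mulrBl mul1r e1l//.
by rewrite subrr subr0.
Qed.

Lemma psd_unitB h t : B h -> star h = h -> nm h <= t -> psd (t *r e - h).
Proof.
move=> Bh sh ht; have := psd_compress (psdB_nm sh ht).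
by rewrite mulrBr mulrBl cstarZr cstarZl mulr1 e1l// e1l// e1r.
Qed.

(** * Values and norms of positive functionals *)

Section PositiveFunctional.
Variable phi : A -> R[i].
Hypotheses (phi_lin : linear_on B phi) (phi_pos : positive_on B phi).

Lemma lin0 : phi 0 = 0.
Proof.
have B0 := subalg0 hB; have := phi_lin 1 B0 B0.
rewrite scale1r addr0 mul1r => /eqP.
by rewrite eq_sym -subr_eq0 addrK => /eqP.
Qed.

Lemma linZ c x : B x -> phi (c *: x) = c * phi x.
Proof. by move=> Bx; rewrite -[_ *: _]addr0 phi_lin ?lin0 ?addr0//; exact: subalg0 hB. Qed.

Lemma linD x y : B x -> B y -> phi (x + y) = phi x + phi y.
Proof. by move=> Bx By; rewrite -[x in LHS]scale1r phi_lin// mul1r. Qed.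

Lemma linN x : B x -> phi (- x) = - phi x.
Proof. by move=> Bx; rewrite -scaleN1r linZ// mulN1r. Qed.

Lemma linB x y : B x -> B y -> phi (x - y) = phi x - phi y.
Proof. by move=> Bx By; rewrite linD ?linN//; exact: subalgN hB _ By. Qed.

Lemma pos_psd a : B a -> psd a -> 0 <= phi a.
Proof.
move=> Ba pa; have [r [Br [sr _] <- _]] := psd_sqrt hB Ba pa.
by rewrite -{1}sr; exact: phi_pos.
Qed.

(** Both [nm h e - h] and [e] are psd, so [phi] is real on them and hence at [h]. *)
Lemma pos_selfadjoint h : B h -> star h = h -> complex.Im (phi h) = 0.
Proof.
move=> Bh sh; have Bu : B (nm h *r e) by exact: subalgZ hB _ _ Be.
have := pos_psd (subalgB hB Bu Bh) (psd_unitB Bh sh (lexx _)).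
have := pos_psd Be psd_unit.
rewrite linB// linZ//; case: (phi e) (phi h) => u v [w z] /=.
rewrite !lecE/= => /andP[/eqP v0 _] /andP[/eqP + _].
by rewrite v0 mulr0 mul0r !add0r => /eqP; rewrite oppr_eq0 => /eqP.
Qed.

Lemma pos_Re_star x : B x -> complex.Re (phi (star x)) = complex.Re (phi x).
Proof.
move=> Bx; have Bsx := Bstar Bx; have Bd := subalgB hB Bx Bsx.
have := @pos_selfadjoint ('i%C *: (x - star x)) (subalgZ hB _ Bd).
rewrite starZ starB starK conj_i scaleNr -scalerN opprB => /(_ erefl); rewrite linZ// linB//.
case: (phi x) (phi (star x)) => u v [w z] /=.
by rewrite mul0r mul1r add0r => /eqP; rewrite subr_eq0 => /eqP.
Qed.

Lemma pos_Re_add x : B x -> complex.Re (phi (x + star x)) = complex.Re (phi x) *+ 2.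
Proof.
by move=> Bx; rewrite linD ?ReD ?pos_Re_star//; exact: Bstar.
Qed.

(** A rotation [c] gives [phi (c x)] the real part [|phi x|], and [c x + star (c x)], of norm at
    most 2, lies below [2 e]. *)
Lemma pos_norm x : B x -> nm x <= 1 -> `|phi x| <= phi e.
Proof.
move=> Bx x1; have [c [c1 cE]] := unimodular_Re (phi x).
have phie := pos_psd Be psd_unit.
rewrite -(RRe_real (normr_real (phi x))) (ge0_ReE phie) lecR -cE -linZ//.
have Bcx : B (c *: x) by exact: subalgZ hB _ _ Bx.
have Bd : B (c *: x + star (c *: x)) by apply: (subalgD hB) => //; exact: Bstar.
have cx2 : nm (c *: x + star (c *: x)) <= 2.
  by rewrite (le_trans (nmD _ _))// nm_star nmZc c1 mul1r -[2]/(1 + 1) lerD.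
have Bu : B (2 *r e) by exact: subalgZ hB _ _ Be.
have := pos_psd (subalgB hB Bu Bd) (psd_unitB Bd _ cx2).
rewrite starD starK addrC => /(_ erefl)/Re_ge0.
rewrite linB// (linZ _ Be) ReD ReN ReZ pos_Re_add// subr_ge0 mulr_natl.
by rewrite ler_pMn2r.
Qed.

Lemma state_intro : phi e = 1 -> states B phi.
Proof.
move=> phie; split=> //; split.
  move=> _ [x [Bx x1] <-]; rewrite -phie; apply: pos_norm => //.
  by move: x1; rewrite nmE -[1]/(1%:C) lecR.
move=> c; apply; exists e; last by rewrite phie normr1.
by split=> //; rewrite nmE -[1]/(1%:C) lecR (nm_subalg_unit hB).
Qed.

Lemma state_unit : states B phi -> phi e = 1.
Proof.
move=> [_ _ [ub lub]]; apply: le_anti; apply/andP; split.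
  rewrite -(ger0_norm (pos_psd Be psd_unit)); apply: ub; exists e => //.
  by split=> //; rewrite nmE -[1]/(1%:C) lecR (nm_subalg_unit hB).
apply: lub => _ [x [Bx x1] <-]; apply: pos_norm => //.
by move: x1; rewrite nmE -[1]/(1%:C) lecR.
Qed.

End PositiveFunctional.

(* [(a, t)] lies in the cone iff the real part of [a] is at most [t e], so that
   [cone_inf state_cone a] is the largest real value at [a] of a state of [B]. *)
Definition state_cone : set (A * R) :=
  [set z | B z.1 /\ psd ((z.2 *r e - z.1) + star (z.2 *r e - z.1))].

Lemma state_dominated phi : states B phi -> dominated state_cone (fun x => complex.Re (phi x)).
Proof.
move=> st; have [lin pos _] := st; move=> x t [/= Bx pc].
have Bc : B (t *r e - x) by apply: (subalgB hB) => //; exact: subalgZ hB _ _ Be.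
have Bu : B (t *r e) by exact: subalgZ hB _ _ Be.
have := Re_ge0 (pos_psd pos (subalgD hB Bc (Bstar Bc)) pc).
rewrite pos_Re_add// (linB lin)// (linZ lin)// (state_unit lin pos st) mulr1.
by rewrite pmulrn_lge0// ReD ReN subr_ge0.
Qed.

(** The state yields [cone_ge0]: it excludes [e = 0], for which every [(0, t)] would lie in the
    cone. *)
Lemma state_cone_sublinear phi : states B phi -> sublinear_cone B state_cone.
Proof.
move=> st; split.
- by move=> x t [].
- move=> x y t u [/= Bx px] [/= By py]; split=> /=; first exact: (subalgD hB).
  have -> : (t + u) *r e - (x + y) = (t *r e - x) + (u *r e - y).
    by rewrite realZDl opprD addrACA.
  by rewrite starD [X in psd X]addrACA; exact: psdD.
- move=> s x t s0 [/= Bx px]; split=> /=; first exact: (subalgZ hB).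
  by rewrite -realZA -scalerBr starZr -scalerDr; apply: psdZ => //; exact: ltW.
- move=> x Bx; exists (nm x); split=> //=.
  rewrite starB starZr se addrACA -opprD -realZDl.
  apply: psd_unitB; first by apply: (subalgD hB) => //; exact: Bstar.
    by rewrite starD starK addrC.
  by rewrite (le_trans (nmD _ _))// nm_star.
- move=> t /(state_dominated st); have [lin _ _] := st.
  by rewrite (lin0 lin).
Qed.

(** The infimum is attained, since [psd] is closed. The perturbation [r 1] of [psd_closed] is split
    into [r e] and [r (1 - e)]. *)
Lemma state_cone_psd phi b : states B phi -> B b ->
  psd ((cone_inf state_cone b *r e - b) + star (cone_inf state_cone b *r e - b)).
Proof.
move=> st Bb; have cS := state_cone_sublinear st; set c := cone_inf _ b.
apply: psd_closed => r r0.
have r2 : 0 < r / 2 by rewrite divr_gt0.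
have hinf : has_inf [set t | state_cone (b, t)].
  have [_ _ _ tot _] := cS; split; first exact: tot.
  by exists c => t bt; exact: cone_inf_le (subalg_real_linear) (subalg0 hB) _ _ _ cS bt.
have [t [_ /= pt] tc] := inf_adherent r2 hinf.
have ct : 0 <= c + r / 2 - t by rewrite subr_ge0 ltW.
have -> : c *r e - b + star (c *r e - b) + r *r (1 : A) =
    (t *r e - b + star (t *r e - b)) + 2 *r ((c + r / 2 - t) *r e) + r *r (1 - e).
  rewrite !starB !starZr se realZA.
  rewrite [t *r e - b + _]addrACA [c *r e - b + _]addrACA -!realZDl.
  move: (- b - star b) => d; rewrite [_ + (2 * _) *r e]addrAC -realZDl scalerBr.
  rewrite [r *r (1 : A) - _]addrC addrA [_ - r *r e]addrAC -realZBl.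
  by congr (_ *r _ + _ + _); field.
apply: psdD; last by apply: psdZ psd_unit_compl; exact: ltW.
by apply: psdD => //; apply: psdZ => //; apply: psdZ => //; exact: psd_unit.
Qed.

(** * States from real-linear functionals *)

Section RealPart.
Variable f : A -> R.
Hypotheses (f_lin : real_linear_on B f) (f_dom : dominated state_cone f).

Definition complexify x : R[i] := (f x -i* f ('i%C *: x))%C.

(** The cone contains [(- h, 0)], and also [(i h, 0)] and [(- i h, 0)], as [i h] has real part
    zero. *)
Let f_psd h : B h -> psd h -> 0 <= f h /\ f ('i%C *: h) = 0.
Proof.
move=> Bh ph; have ih : B ('i%C *: h) by exact: subalgZ hB _ _ Bh.
have sh : star h = h by case: ph.
have fN x := real_linearN (subalg0 hB) f_lin (x := x).
split.
  rewrite -oppr_le0 -fN//; apply: f_dom; split=> /=; first exact: subalgN hB _ Bh.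
  by rewrite realZ0 sub0r opprK sh; exact: psdD.
apply/eqP; rewrite eq_le -[X in _ && X]oppr_le0 -fN//; apply/andP; split; apply: f_dom.
  split=> //=; rewrite realZ0 sub0r starN starZ sh conj_i scaleNr opprK addNr.
  exact: psd0.
split=> /=; first exact: subalgN hB _ ih.
by rewrite realZ0 sub0r opprK starZ sh conj_i scaleNr subrr; exact: psd0.
Qed.

Lemma complexify_state : states B complexify.
Proof.
have lD x y := real_linearD f_lin (x := x) (y := y).
have lZ t x := real_linearZ (subalg0 hB) t f_lin (x := x).
have lN x := real_linearN (subalg0 hB) f_lin (x := x).
have BZ (c : R[i]) x : B x -> B (c *: x) by exact: subalgZ hB c x.
have iE (u v : R) x : (u +i* v)%C *: x = u *r x + v *r ('i%C *: x).
  rewrite scalerA -scalerDl; congr (_ *: _).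
  by apply/eqP; rewrite eq_complex/= !mul0r !mulr0 !mulr1 !subr0 !addr0 add0r !eqxx.
have ii x : 'i%C *: ('i%C *: x) = - x by rewrite scalerA mulii scaleN1r.
have lin : linear_on B complexify.
  move=> [u v] x y Bx By; rewrite /complexify iE.
  have Bix := BZ 'i%C _ Bx; have Biy := BZ 'i%C _ By.
  have Bux := BZ u%:C _ Bx; have Bvix := BZ v%:C _ Bix.
  have -> : 'i%C *: (u *r x + v *r ('i%C *: x) + y) = u *r ('i%C *: x) + (v *r (- x) + 'i%C *: y).
    rewrite !scalerDr -addrA -ii !scalerA; by congr (_ *: _ + (_ *: _ + _)); ring.
  have Nx := subalgN hB Bx; have Bvx := BZ v%:C _ Nx; have Buix := BZ u%:C _ Bix.
  rewrite !lD ?lZ ?lN//; [|exact: subalgD hB _ _ _ _|exact: subalgD hB _ _ _ _].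
  by apply/eqP; rewrite eq_complex/=; apply/andP; split; apply/eqP; ring.
have pos : positive_on B complexify.
  move=> x Bx; have Bsx : B (star x * x) by case: (hB) => _ M S _ _ _ _; apply: M => //; exact: S.
  have [h1 h2] := f_psd Bsx (psd_starM x).
  by rewrite /complexify h2 lecE/= oppr0 eqxx h1.
apply: state_intro => //.
have [f0 fi] := f_psd Be psd_unit.
(* Both [(e, 1)] and [(- e, - 1)] lie in the cone, so [f e = 1]. *)
rewrite /complexify fi oppr0; congr Complex; apply/eqP; rewrite eq_le; apply/andP; split.
  by apply: f_dom; split=> //=; rewrite realZ1 subrr star0 addr0; exact: psd0.
rewrite -lerN2 -lN//; apply: f_dom; split=> /=; first exact: subalgN hB _ Be.
by rewrite realZNl realZ1 subrr star0 addr0; exact: psd0.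
Qed.

End RealPart.

Lemma linear_complexify phi x : linear_on B phi -> B x ->
  phi x = complexify (fun x => complex.Re (phi x)) x.
Proof.
move=> lin Bx; rewrite /complexify (linZ lin)//; case: (phi x) => u v /=.
by rewrite mul0r mul1r add0r opprK.
Qed.

Lemma state_real_linear phi : states B phi -> real_linear_on B (fun x => complex.Re (phi x)).
Proof. by move=> [lin _ _] s x y Bx By /=; rewrite lin// ReD ReZ. Qed.

(** Real parts of states are dominated by [state_cone], and [complexify] leads back; so an extreme
    dominated functional, chosen maximal at [b], gives a pure state. *)
Lemma pure_state_max phi b : states B phi -> B b ->
  exists2 psi, pure_states B psi & complex.Re (psi b) = cone_inf state_cone b.
Proof.
move=> st Bb; have cS := state_cone_sublinear st.
have [f [lf df fb fx]] := extreme_dominated subalg_real_linear (subalg0 hB) cS Bb.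
exists (complexify f) => //; split; first exact: complexify_state.
move=> t psi1 psi2 t01 st1 st2 E.
have [lin1 _ _] := st1; have [lin2 _ _] := st2.
have H := fx t _ _ t01 (state_real_linear st1) (state_real_linear st2)
   (state_dominated st1) (state_dominated st2) _.
have {H}H : forall x, B x -> complex.Re (psi1 x) = f x /\ complex.Re (psi2 x) = f x.
  by apply: H => x Bx; have /(congr1 (@complex.Re R)) := E x Bx; rewrite ReD !ReZ.
move=> x Bx; have Bix : B ('i%C *: x) by exact: subalgZ hB _ _ Bx.
have [h1 h2] := H x Bx; have [h3 h4] := H _ Bix.
by rewrite (linear_complexify lin1 Bx) (linear_complexify lin2 Bx) /complexify h1 h2 h3 h4.
Qed.

End States.

(** * Module independence *)

Section ModuleIndependence.
Context {R : realType} {A : unitalCStarAlgType R}.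
Implicit Types (x y a b e : A) (s t u m : R) (B : set A) (phi psi : A -> R[i]).

Section OneSubalgebra.
Context {B : set A} {e : A} (hB : unital_cstar_subalgebra B e).

(** Cauchy-Schwarz for [b] and the unit: expand [psi ((b - t e)^2) >= 0] at [t = psi b]. *)
Lemma state_sqr_ge psi b : states B psi -> B b -> psd b -> psi b ^+ 2 <= psi (b * b).
Proof.
move=> st Bb pb; have [lin pos _] := st; have [_ Bmul _ _ Be e1l e1r] := hB.
have E := ge0_ReE (pos_psd hB pos Bb pb); set t := complex.Re _ in E.
have Bte : B (t *r e) by exact: subalgZ hB _ _ Be.
have Bd := subalgB hB Bb Bte.
have sd : star (b - t *r e) = b - t *r e.
  by rewrite starB starZr (star_subalg_unit hB) (proj1 pb).
have := pos _ Bd; rewrite sd mulrBr !mulrBl !cstarZl !cstarZr e1l// e1r// e1l//.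
have Btb : B (t *r b) by exact: subalgZ hB _ _ Bb.
have Btte : B (t *r (t *r e)) by exact: subalgZ hB _ _ Bte.
have Bbb := Bmul _ _ Bb Bb.
rewrite (linB hB lin (subalgB hB Bbb Btb) (subalgB hB Btb Btte)).
rewrite (linB hB lin Bbb Btb) (linB hB lin Btb Btte) !(linZ hB lin)//.
by rewrite (state_unit hB lin pos st) mulr1 E subrr subr0 subr_ge0 expr2.
Qed.

(** One direction is [state_sqr_ge], the other is [b^2 <= nm b b]. At [b = |x|] it says that [x] is
    in the left kernel exactly when [psi |x| = 0]. *)
Lemma state_sqr_eq0 psi b : states B psi -> B b -> psd b ->
  psi (b * b) = 0 <-> psi b = 0.
Proof.
move=> st Bb pb; have [lin pos _] := st; have [_ Bmul _ _ _ _ _] := hB.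
have pb0 := pos_psd hB pos Bb pb; split=> h.
  have := state_sqr_ge st Bb pb; rewrite h => b2.
  have : psi b ^+ 2 == 0 by rewrite eq_le b2 exprn_ge0.
  by rewrite expf_eq0/= => /eqP.
have Bbb := Bmul _ _ Bb Bb; have Btb : B (nm b *r b) by exact: subalgZ hB _ _ Bb.
have pbb : psd (nm b *r b - b * b).
  rewrite (_ : _ - _ = b * (nm b *r (1 : A) - b)); last by rewrite mulrBr cstarZr mulr1.
  apply: psdM => //; first by apply: psdB_nm => //; case: pb.
  by apply: commrB => //; exact: comm_scalar.
have := pos_psd hB pos (subalgB hB Btb Bbb) pbb.
rewrite (linB hB lin)// (linZ hB lin)// h mulr0 sub0r oppr_ge0 => bb0.
by apply/eqP; rewrite eq_le bb0 (pos_psd hB pos)//; apply: sqr_psd; case: pb.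
Qed.

Section Restriction.
Variable phi : A -> R[i].
Hypothesis st : states [set: A] phi.

Let lin : linear_on [set: A] phi. Proof. by case: st. Qed.
Let linOn : linear_on B phi. Proof. by move=> c x y _ _; exact: lin. Qed.
Let pos : positive_on [set: A] phi. Proof. by case: st. Qed.
Let posB : positive_on B phi. Proof. by move=> x _; exact: pos. Qed.
Let Be : B e. Proof. by case: hB. Qed.

Lemma state_unitE : phi e = (complex.Re (phi e))%:C.
Proof. exact: ge0_ReE (pos_psd subalgT pos _ (psd_unit hB)). Qed.

Lemma state_unit_le1 : phi e <= 1.
Proof.
have := pos_psd subalgT pos _ (psd_unit_compl hB) => /(_ I).
by rewrite (linB subalgT lin)// (state_unit subalgT lin pos st) subr_ge0.
Qed.

Lemma state_Re_unit_le1 : complex.Re (phi e) <= 1.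
Proof. by have := state_unit_le1; rewrite {1}state_unitE -[1]/(1%:C) lecR. Qed.

Lemma state_Re_unit m : (m%:C <= phi e) = (m <= complex.Re (phi e)).
Proof. by rewrite state_unitE lecR. Qed.

Lemma multiple_on_unit psi : states B psi -> multiple_on B phi psi ->
  forall x, B x -> phi x = phi e * psi x.
Proof.
move=> stB [c cE] x Bx; have [l p _] := stB.
by rewrite (cE _ Be) (state_unit hB l p stB) mulr1 -cE.
Qed.

(* If [psi b] is the largest real part at [b] of a state of [B], then [beta e - b]
   has a psd real part which [psi] annihilates; so does every positive functional
   with the same left kernel. *)
Lemma left_kernel_max psi b : states B psi -> B b ->
  complex.Re (psi b) = cone_inf (@state_cone R A B e) b ->
  left_kernel B phi = left_kernel B psi ->
  complex.Re (phi b) = complex.Re (phi e) * cone_inf (@state_cone R A B e) b.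
Proof.
move=> stB Bb psib ker; set beta := cone_inf _ _ in psib *.
have [l p _] := stB; have [_ _ Bstar _ _ _ _] := hB.
have Bte : B (beta *r e) by exact: subalgZ hB _ _ Be.
have Bc : B (beta *r e - b) := subalgB hB Bte Bb.
have Bcc := subalgD hB Bc (Bstar _ Bc).
have pcc := state_cone_psd hB stB Bb; rewrite -/beta in pcc.
have ReE chi : linear_on B chi -> positive_on B chi ->
    complex.Re (chi (beta *r e - b + star (beta *r e - b))) =
    (beta * complex.Re (chi e) - complex.Re (chi b)) *+ 2.
  move=> lc pc; rewrite (pos_Re_add hB lc pc Bc) (linB hB lc)// (linZ hB lc)//.
  by rewrite ReD ReN ReZ.
(* The root [d] turns annihilation of a positive element into membership in a left kernel. *)
have [d [Bd [sd _] dE _]] := psd_sqrt hB Bcc pcc.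
have : left_kernel B psi d.
  split=> //; rewrite sd dE (ge0_ReE (pos_psd hB p Bcc pcc)) ReE// psib.
  by rewrite (state_unit hB l p stB) mulr1 subrr mul0rn.
rewrite -ker => -[_]; rewrite sd dE => /(congr1 (@complex.Re R)); rewrite ReE//=.
by move/eqP; rewrite mulrn_eq0/= subr_eq0 mulrC => /eqP.
Qed.

(** The lower bound is zero on the kernel of [psi]; used at [z] and [- z], and at [i z], it makes
    [phi] vanish there, in particular at [x - psi x e]. At [e] it reads [m <= Re (phi e)]. *)
Lemma multiple_on_dominated psi m : states B psi -> m <= 1 ->
  (forall b, B b -> Num.min (m * complex.Re (psi b)) (complex.Re (psi b)) <= complex.Re (phi b)) ->
  m%:C <= phi e /\ multiple_on B phi psi.
Proof.
move=> stB m1 le; have [l p _] := stB; have psie := state_unit hB l p stB.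
split.
  by rewrite state_Re_unit; have := le _ Be; rewrite psie/= mulr1 min_l.
exists (phi e) => x Bx; pose y := x - psi x *: e.
have Bze : B (psi x *: e) by exact: subalgZ hB _ _ Be.
have By : B y by apply: (subalgB hB).
have psiy : psi y = 0 by rewrite (linB hB l)// (linZ hB l)// psie mulr1 subrr.
have Re0 z : B z -> psi z = 0 -> complex.Re (phi z) = 0.
  move=> Bz z0; apply/eqP; rewrite eq_le; apply/andP; split.
    have := le _ (subalgN hB Bz); rewrite (linN hB l)// z0 oppr0/= mulr0 min_l//.
    by rewrite (linN hB linOn)// ReN oppr_ge0.
  by have := le _ Bz; rewrite z0/= mulr0 min_l.
have phiy : phi y = 0.
  have h1 := Re0 _ By psiy.
  have Biy : B ('i%C *: y) by exact: subalgZ hB _ _ By.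
  have := Re0 _ Biy; rewrite (linZ hB l)// psiy mulr0 => /(_ erefl).
  rewrite (linZ hB linOn)//; move: h1; case: (phi y) => u v /= ->.
  by rewrite mul0r mul1r add0r => /eqP; rewrite oppr_eq0 => /eqP ->.
move: phiy; rewrite (linB hB linOn)// (linZ hB linOn)// => /eqP.
by rewrite subr_eq0 mulrC => /eqP.
Qed.

End Restriction.
End OneSubalgebra.

(** * Common extension, up to factors, of states of two subalgebras *)

Section Joint.
Context {A1 A2 : set A} {e1 e2 : A}.
Hypotheses (hA1 : unital_cstar_subalgebra A1 e1) (hA2 : unital_cstar_subalgebra A2 e2).

(** The factors in [joint_state] vary with [b1] and [b2]; this single superadditive function of [s]
    copes with all of them. *)
Lemma min_linear_le m c s : 0 < m -> m <= c <= 1 -> Num.min (m * s) s <= c * s.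
Proof.
move=> m0 /andP[mc c1]; rewrite ge_min.
by have [s0|s0] := leP 0 s; apply/orP; [left|right]; nra.
Qed.

(* Hahn-Banach in the form of Mazur and Orlicz: on real parts the wanted state
   [phi] is a linear functional below the sublinear functional of the states of
   [A] and above [b1 + b2 |-> q (phi1 b1) + q (phi2 b2)], [q s := min (m s) s].
   Such a [phi] vanishes on the kernel of [phi1] in [A1] and of [phi2] in [A2]. *)
Lemma joint_state m phi1 phi2 : 0 < m -> states A1 phi1 -> states A2 phi2 ->
  (forall b1 b2, A1 b1 -> A2 b2 -> exists phi c1 c2,
     [/\ states [set: A] phi, m <= c1 <= 1, m <= c2 <= 1,
        complex.Re (phi b1) = c1 * cone_inf (@state_cone R A A1 e1) b1 &
        complex.Re (phi b2) = c2 * cone_inf (@state_cone R A A2 e2) b2]) ->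
  exists phi, [/\ states [set: A] phi, m%:C <= phi e1, m%:C <= phi e2,
    multiple_on A1 phi phi1 & multiple_on A2 phi phi2].
Proof.
move=> m0 st1 st2 H; pose q s := Num.min (m * s) s.
have [lin1 _ _] := st1; have [lin2 _ _] := st2.
pose q1 b := q (complex.Re (phi1 b)); pose q2 b := q (complex.Re (phi2 b)).
have qD s t : q s + q t <= q (s + t).
  by rewrite le_min mulrDr !lerD// ge_min lexx ?orbT.
have qZ s t : 0 < s -> q (s * t) = s * q t.
  by move=> s0; rewrite /q minr_pMr ?ltW// mulrCA.
have q0 : q 0 = 0 by rewrite /q mulr0 min_l.
have [phi0 [c1 [c2 [st0 /andP[mc1 c11] _ _ _]]]] := H _ _ (subalg0 hA1) (subalg0 hA2).
have m1 : m <= 1 := le_trans mc1 c11.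
pose S := @state_cone R A [set: A] 1.
have cS : sublinear_cone [set: A] S := state_cone_sublinear subalgT st0.
(* This encodes the Mazur-Orlicz functional: the infimum over [b1], [b2] of
   [p (x + b1 + b2) - q1 b1 - q2 b2], with [p = cone_inf S]. *)
pose G : set (A * R) := [set z | exists b1 b2 s, [/\ A1 b1, A2 b2,
  S (z.1 + (b1 + b2), s) & s - (q1 b1 + q2 b2) <= z.2]].
have SG : S `<=` G.
  move=> [x t] Sx; exists 0, 0, t; split; [exact: subalg0 hA1|exact: subalg0 hA2| |].
    by rewrite !addr0.
  by rewrite /q1 /q2 (lin0 hA1 lin1) (lin0 hA2 lin2) !q0 addr0 subr0.
have [_ SD SZ Stot _] := cS.
have cG : sublinear_cone [set: A] G.
  split=> //.
  - move=> x y t u [b1 [b2 [s [B1 B2 Sx st]]]] [d1 [d2 [r [D1 D2 Sy ru]]]].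
    exists (b1 + d1), (b2 + d2), (s + r).
    split; [exact: subalgD hA1 _ _ _ _|exact: subalgD hA2 _ _ _ _| |].
      have := SD _ _ _ _ Sx Sy.
      by rewrite /= [X in S (X, _)]addrACA [b1 + b2 + _]addrACA.
    have h1 := qD (complex.Re (phi1 b1)) (complex.Re (phi1 d1)).
    have h2 := qD (complex.Re (phi2 b2)) (complex.Re (phi2 d2)).
    move: st ru h1 h2; rewrite /q1 /q2/= (linD lin1)// (linD lin2)// !ReD; lra.
  - move=> r x t r0 [b1 [b2 [s [B1 B2 Sx st]]]].
    exists (r *r b1), (r *r b2), (r * s).
    split; [exact: subalgZ hA1 _ _ _|exact: subalgZ hA2 _ _ _| |].
      by rewrite /= -!scalerDr; exact: SZ Sx.
    rewrite /q1 /q2/= (linZ hA1 lin1)// (linZ hA2 lin2)// !ReZ !qZ//.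
    by rewrite -mulrDr -mulrBr ler_pM2l.
  - by move=> x /Stot[t St]; exists t; exact: SG.
  (* Here the hypothesis enters: the [phi] given for [b1], [b2] yields
     [s >= Re (phi (b1 + b2)) >= q1 b1 + q2 b2]. *)
  - move=> t [b1 [b2 [s [B1 B2 /= Sb]]]]; rewrite add0r in Sb; apply: le_trans.
    have [phi [d1 [d2 [st d1m d2m E1 E2]]]] := H _ _ B1 B2.
    have := state_dominated subalgT st Sb; have [lin _ _] := st.
    rewrite (linD lin)// ReD E1 E2 subr_ge0; apply: le_trans.
    have d1p : 0 <= d1 by case/andP: d1m => /(le_trans (ltW m0)).
    have d2p : 0 <= d2 by case/andP: d2m => /(le_trans (ltW m0)).
    have i1 := dominated_inf (state_cone_sublinear hA1 st1) (state_dominated hA1 st1) B1.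
    have i2 := dominated_inf (state_cone_sublinear hA2 st2) (state_dominated hA2 st2) B2.
    apply: lerD.
      by apply: le_trans (min_linear_le _ m0 d1m) _; rewrite ler_wpM2l.
    by apply: le_trans (min_linear_le _ m0 d2m) _; rewrite ler_wpM2l.
have [f [lf df _ _]] := extreme_dominated (fun _ _ _ _ _ => I) I cG (I : [set: A] 0).
have stf : states [set: A] (complexify f).
  by apply: (complexify_state subalgT lf) => x t Sx; apply: df; exact: SG.
have fN x : f (- x) = - f x by exact: (real_linearN (W := [set: A]) I lf I).
have S0 : S (0, 0) by split=> //=; rewrite realZ0 subrr star0 addr0; exact: psd0.
(* The shift by [b] puts [(- b, - q1 b)] into [G]. *)
have f1 b : A1 b -> q1 b <= f b.
  move=> Bb; rewrite -lerN2 -fN; apply: df; exists b, 0, 0.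
  split=> //=; [exact: subalg0 hA2|by rewrite addr0 addNr|].
  by rewrite /q2 (lin0 hA2 lin2) q0 addr0 sub0r.
have f2 b : A2 b -> q2 b <= f b.
  move=> Bb; rewrite -lerN2 -fN; apply: df; exists 0, b, 0.
  split=> //=; [exact: subalg0 hA1|by rewrite add0r addNr|].
  by rewrite sub0r /q1 (lin0 hA1 lin1) q0 add0r.
have [h1 k1] := multiple_on_dominated hA1 stf st1 m1 f1.
have [h2 k2] := multiple_on_dominated hA2 stf st2 m1 f2.
by exists (complexify f).
Qed.

End Joint.
End ModuleIndependence.

Theorem theorem2p2 (R : realType) (A : unitalCStarAlgType R)
    (A1 A2 : set A) (e1 e2 : A)
    (hA1 : unital_cstar_subalgebra A1 e1)
    (hA2 : unital_cstar_subalgebra A2 e2) :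
  [<-> module_independent A1 A2;
       exists m : R, 0 < m /\
         forall phi1 phi2, states A1 phi1 -> states A2 phi2 ->
           exists phi, [/\ states [set: A] phi,
             m%:C <= phi e1, m%:C <= phi e2,
             left_kernel A1 phi = left_kernel A1 phi1 &
             left_kernel A2 phi = left_kernel A2 phi2];
       exists m : R, 0 < m /\
         forall phi1 phi2, pure_states A1 phi1 -> pure_states A2 phi2 ->
           exists phi, [/\ states [set: A] phi,
             m%:C <= phi e1, m%:C <= phi e2,
             multiple_on A1 phi phi1 &
             multiple_on A2 phi phi2];
       exists m : R, 0 < m /\
         forall phi1 phi2, states A1 phi1 -> states A2 phi2 ->
           exists phi, [/\ states [set: A] phi,
             m%:C <= phi e1, m%:C <= phi e2,
             multiple_on A1 phi phi1 &
             multiple_on A2 phi phi2]].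

Proof.
tfae.
(* The lower bound at [e] gives [phi e >= m]. The lower bounds carry null elements of [phi] to the
   given states, the upper bounds carry them back. *)
- move=> [m [M [m0 M0 H]]]; exists m; split=> // phi1 phi2 st1 st2.
  have [phi [st le1 le2]] := H _ _ st1 st2; exists phi.
  have [lin pos _] := st.
  have main B e psi : unital_cstar_subalgebra B e -> states B psi ->
      (forall x, B x -> m%:C * psi (cstar_abs x) <= phi (cstar_abs x)
            <= M%:C * sqrtC (psi (cstar_abs x ^+ 2))) ->
      m%:C <= phi e /\ left_kernel B phi = left_kernel B psi.
    move=> hB stB le; have [l p _] := stB; have [_ _ _ _ Be e1l _] := hB; split.
      have ae : cstar_abs e = e.
        by apply: cstar_abs_eq (psd_unit hB) _; rewrite (star_subalg_unit hB).
      by have /andP[] := le _ Be; rewrite ae (state_unit hB l p stB) mulr1.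
    apply/seteqP; split=> x [Bx x0]; split=> //; have /andP[l1 l2] := le x Bx;
      have [Ba pa aE] := cstar_absP hB Bx; move: x0; rewrite -aE.
      move/(state_sqr_eq0 subalgT st I pa) => a0; apply/(state_sqr_eq0 hB stB Ba pa).
      move: l1; rewrite a0 pmulr_rle0 ?ltcR// => l1.
      by apply/eqP; rewrite eq_le l1 (pos_psd hB p).
    move=> a0; apply/(state_sqr_eq0 subalgT st I pa).
    move: l2; rewrite expr2 a0 sqrtC0 mulr0 => l2.
    by apply/eqP; rewrite eq_le l2 (pos_psd subalgT pos).
  have [h1 k1] := main _ _ _ hA1 st1 le1; have [h2 k2] := main _ _ _ hA2 st2 le2.
  by split.
(* Kernels are compared only with states maximal at [b1] and [b2], where [left_kernel_max] supplies
   the values that [joint_state] asks for. *)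
- move=> [m [m0 H]]; exists m; split=> // phi1 phi2 [st1 _] [st2 _].
  apply: (joint_state hA1 hA2) => // b1 b2 B1 B2.
  have [psi1 [s1 _] E1] := pure_state_max hA1 st1 B1.
  have [psi2 [s2 _] E2] := pure_state_max hA2 st2 B2.
  have [phi [st h1 h2 k1 k2]] := H _ _ s1 s2.
  exists phi, (complex.Re (phi e1)), (complex.Re (phi e2)).
  rewrite -(state_Re_unit hA1 st) -(state_Re_unit hA2 st) h1 h2.
  rewrite (state_Re_unit_le1 hA1 st) (state_Re_unit_le1 hA2 st); split=> //.
    exact: left_kernel_max s1 B1 E1 k1.
  exact: left_kernel_max s2 B2 E2 k2.
- move=> [m [m0 H]]; exists m; split=> // phi1 phi2 st1 st2.
  apply: (joint_state hA1 hA2) => // b1 b2 B1 B2.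
  have [psi1 p1 E1] := pure_state_max hA1 st1 B1.
  have [psi2 p2 E2] := pure_state_max hA2 st2 B2.
  have [phi [st h1 h2 k1 k2]] := H _ _ p1 p2.
  exists phi, (complex.Re (phi e1)), (complex.Re (phi e2)).
  rewrite -(state_Re_unit hA1 st) -(state_Re_unit hA2 st) h1 h2.
  rewrite (state_Re_unit_le1 hA1 st) (state_Re_unit_le1 hA2 st).
  rewrite (multiple_on_unit hA1 (proj1 p1) k1 B1) (multiple_on_unit hA2 (proj1 p2) k2 B2).
  by rewrite (state_unitE hA1 st) (state_unitE hA2 st) !ReZ E1 E2.
(* On each subalgebra [phi = phi e * psi] with [m <= phi e <= 1]; Cauchy-Schwarz then gives the
   upper bound with [M = 1]. *)
- move=> [m [m0 H]]; exists m, 1; split=> // phi1 phi2 st1 st2.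
  have [phi [st h1 h2 k1 k2]] := H _ _ st1 st2; exists phi.
  have main B e psi : unital_cstar_subalgebra B e -> states B psi ->
      m%:C <= phi e -> multiple_on B phi psi ->
      forall x, B x -> m%:C * psi (cstar_abs x) <= phi (cstar_abs x)
            <= 1%:C * sqrtC (psi (cstar_abs x ^+ 2)).
    move=> hB stB me k x Bx; have [Ba pa aE] := cstar_absP hB Bx.
    have [l p _] := stB; have a0 := pos_psd hB p Ba pa.
    rewrite (multiple_on_unit hB stB k Ba) ler_wpM2r//= mul1r expr2.
    apply: (@le_trans _ _ (psi (cstar_abs x))).
      by rewrite ler_piMl// (state_unit_le1 hB st).
    rewrite -[leLHS]sqrCK// ler_sqrtC ?nnegrE ?exprn_ge0//.
      exact: state_sqr_ge hB _ _ stB Ba pa.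
    by rewrite (le_trans _ (state_sqr_ge hB stB Ba pa))// exprn_ge0.
  by split=> //; [exact: main h1 k1|exact: main h2 k2].
Qed.
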